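(* Let $f\in L^2(0,2\pi)$ satisfy $\widehat f_k\neq 0$ for all $k\in\mathbb{Z}$, let $b>0$ be a constant having property (B) described in the context, let $\beta\ge b$, and let $$\widetilde{\mathcal H}=\left\{h\in L^2(0,2\pi):\ \sum_{k\in\mathbb{Z}}\left|\frac{\widehat h_k}{\widehat f_k}\right|^2e^{\beta k^6}<\infty\right\}.$$ Then there exists $T>0$ such that, for any $u_0\in\widetilde{\mathcal H}$, there exists a control $v\in L^2(0,T)$ for which the solution $u$ of $$\begin{cases}u_t-u_{5x}+u_{3x}+u_x=f(x)v(t), & (t,x)\in(0,T)\times(0,2\pi),\\ \partial_x^ju(t,0)=\partial_x^ju(t,2\pi), & t\in(0,T),\ j=0,1,2,3,4,\\ u(0,x)=u_0(x), & x\in(0,2\pi),\end{cases}$$ satisfies $u(T,x)=0$.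
   Context: For $h\in L^2(0,2\pi)$ and $k\in\mathbb{Z}$, $\widehat h_k=\frac1{2\pi}\int_0^{2\pi}h(x)e^{-ikx}\,dx$. Subscripts $x,3x,5x$ denote first, third and fifth partial derivatives in $x$. The solution of the linear system is the unique weak (mild) solution $u\in C([0,T];L^2(0,2\pi))$ given by the group of isometries of $L^2(0,2\pi)$ generated by $Au=\partial_x^5u-\partial_x^3u-\partial_xu$ with domain $D(A)=H^5_p(0,2\pi)$, the periodic Sobolev space of order 5, i.e. the functions $v\in L^2(0,2\pi)$ with $\sum_k|\widehat v_k|^2(1+k^2)^5<\infty$. Let $\lambda_n=-in(n^4+n^2-1)$, $n\in\mathbb{Z}$ (the eigenvalues of $A$), and $\mathbb{Z}^*=\mathbb{Z}\setminus\{0\}$. Property (B) of $b>0$: there exist constants $T_0>2\pi$ and $C>0$ and a sequence $(\zeta_m)_{m\in\mathbb{Z}}\subset L^2(-\frac{T_0}2,\frac{T_0}2)$ biorthogonal to $(e^{-\lambda_mt})_{m\in\mathbb{Z}}$, i.e. $\int_{-T_0/2}^{T_0/2}\zeta_m(t)e^{\lambda_nt}\,dt=\delta_{mn}$ for all $m,n\in\mathbb{Z}$ (note $\overline{e^{-\lambda_nt}}=e^{\lambda_nt}$ because $\lambda_n$ is purely imaginary), such that $$\int_{-T_0/2}^{T_0/2}\Big|\sum_{m\in\mathbb{Z}^*}c_m\zeta_m(t)\Big|^2dt\le C\sum_{m\in\mathbb{Z}^*}|c_m|^2e^{2bm^6}$$ for any sequence $(c_m)_{m\in\mathbb{Z}^*}$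 of complex numbers (if the right-hand side is infinite there is nothing to assert; otherwise the series on the left converges in $L^2$). *)

(* Defs.v *)
From mathcomp Require Import all_boot all_order all_algebra.
From mathcomp Require Import complex.
From mathcomp Require Import all_classical all_reals all_analysis.

Set Implicit Arguments.
Unset Strict Implicit.
Unset Printing Implicit Defensive.

Import Order.TTheory GRing.Theory Num.Theory.
Import numFieldNormedType.Exports.
Import Normc.

Local Open Scope classical_set_scope.
Local Open Scope ring_scope.

(* Elements of the complex spaces L^2(a,b) are represented by functions
   h : R -> R[i]; only their values on `]a, b[ matter, and equality in L^2(a,b)
   is L2eq a b.  Measurability and integrals of complex
   functions are taken on real and imaginary parts. *)

Definition L2eq (R : realType) (a b : R) (h g : R -> R[i]) : Prop :=
  {ae (@lebesgue_measure R), forall x, x \in `]a, b[ -> h x = g x}.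

Definition cintegrable (R : realType) (a b : R) (h : R -> R[i]) : Prop :=
  lebesgue_measure.-integrable `]a, b[ (fun x => (complex.Re (h x))%:E) /\
  lebesgue_measure.-integrable `]a, b[ (fun x => (complex.Im (h x))%:E).

Definition cint (R : realType) (a b : R) (h : R -> R[i]) : R[i] :=
  Complex (\int[lebesgue_measure]_(x in `]a, b[) complex.Re (h x))
          (\int[lebesgue_measure]_(x in `]a, b[) complex.Im (h x)).

Definition L2sqnorm (R : realType) (a b : R) (h : R -> R[i]) : \bar R :=
  (\int[lebesgue_measure]_(x in `]a, b[) (normc (h x) ^+ 2)%:E)%E.

Definition L2 (R : realType) (a b : R) (h : R -> R[i]) : Prop :=
  [/\ measurable_fun `]a, b[ (fun x => complex.Re (h x)),
      measurable_fun `]a, b[ (fun x => complex.Im (h x)) &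
      (L2sqnorm a b h < +oo)%E].

Definition L2inner (R : realType) (a b : R) (h g : R -> R[i]) : R[i] :=
  cint a b (fun x => h x * conjc (g x)).

Definition cexp (R : realType) (z : R[i]) : R[i] :=
  real_complex R (expR (complex.Re z))
  * Complex (cos (complex.Im z)) (sin (complex.Im z)).

Definition fourier (R : realType) (h : R -> R[i]) (k : int) : R[i] :=
  real_complex R (2 * pi)^-1
  * cint 0 (2 * pi)
      (fun x => h x * cexp (- (Complex 0 1 * k%:~R * real_complex R x))).

(* lambda_n = - i n (n^4 + n^2 - 1); the eigenfunction is e^{-inx}. *)
Definition eigval (R : realType) (n : int) : R[i] :=
  - (Complex 0 1 * n%:~R * (n%:~R ^+ 4 + n%:~R ^+ 2 - 1)).

Definition H5p (R : realType) (h : R -> R[i]) : Prop :=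
  L2 0 (2 * pi) h /\
  (\esum_(k in [set: int])
     (normc (fourier h k) ^+ 2 * (1 + (k%:~R : R) ^+ 2) ^+ 5)%:E < +oo)%E.

Definition test_function (R : realType) (phi : R -> R) : Prop :=
  (forall (n : nat) (x : R), derivable (derive1n n phi) x 1) /\
  (exists c d : R, [/\ 0 < c, d < 2 * pi &
     forall x, x \notin `[c, d] -> phi x = 0]).

Definition weak_derivative (R : realType) (j : nat) (h d : R -> R[i]) : Prop :=
  L2 0 (2 * pi) d /\
  forall phi : R -> R, test_function phi ->
    cint 0 (2 * pi) (fun x => real_complex R (derive1n j phi x) * h x)
    = (-1) ^+ j * cint 0 (2 * pi) (fun x => real_complex R (phi x) * d x).

(* The graph of A u = u_{5x} - u_{3x} - u_x with domain H^5_p(0,2pi); the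
   periodic boundary conditions are encoded in the domain. *)
Definition opA (R : realType) (h g : R -> R[i]) : Prop :=
  H5p h /\
  exists d1 d3 d5 : R -> R[i],
    [/\ weak_derivative 1 h d1, weak_derivative 3 h d3,
        weak_derivative 5 h d5 &
        L2eq 0 (2 * pi) g
          (fun x => d5 x - d3 x - d1 x)].

Record isometry_group (R : realType) (S : R -> (R -> R[i]) -> (R -> R[i])) :
    Prop := IsometryGroup {
  group_L2 : forall t h, L2 0 (2 * pi) h -> L2 0 (2 * pi) (S t h);
  group_linear : forall t (a : R[i]) h g,
    L2 0 (2 * pi) h -> L2 0 (2 * pi) g ->
    L2eq 0 (2 * pi)
      (S t (fun x => a * h x + g x)) (fun x => a * S t h x + S t g x);
  group_isometry : forall t h, L2 0 (2 * pi) h ->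
    L2sqnorm 0 (2 * pi) (S t h) = L2sqnorm 0 (2 * pi) h;
  group_id : forall h, L2 0 (2 * pi) h ->
    L2eq 0 (2 * pi) (S 0 h) h;
  group_add : forall s t h, L2 0 (2 * pi) h ->
    L2eq 0 (2 * pi) (S (s + t) h) (S s (S t h));
  group_continuous : forall h, L2 0 (2 * pi) h ->
    L2sqnorm 0 (2 * pi) (fun x => S t h x - h x) @[t --> (0 : R)] --> 0%E
}.

(* A, given by its graph, is the infinitesimal generator of S:
   h is in D(A) and A h = g iff (S(t) h - h) / t --> g in L^2 as t --> 0. *)
Definition generates (R : realType) (A : (R -> R[i]) -> (R -> R[i]) -> Prop)
    (S : R -> (R -> R[i]) -> (R -> R[i])) : Prop :=
  isometry_group S /\
  forall h g, L2 0 (2 * pi) h -> L2 0 (2 * pi) g ->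
    (A h g <->
     L2sqnorm 0 (2 * pi)
       (fun x => real_complex R t^-1 * (S t h x - h x) - g x)
       @[t --> (0 : R)^'] --> 0%E).

(* w is the L^2(0,2pi)-valued integral of F over (0,t), characterized by
   duality (for Bochner integrable F it coincides with the Bochner integral). *)
Definition is_L2_integral (R : realType) (t : R) (F : R -> R -> R[i])
    (w : R -> R[i]) : Prop :=
  L2 0 (2 * pi) w /\
  forall phi, L2 0 (2 * pi) phi ->
    cintegrable 0 t (fun s => L2inner 0 (2 * pi) (F s) phi) /\
    L2inner 0 (2 * pi) w phi
    = cint 0 t (fun s => L2inner 0 (2 * pi) (F s) phi).

Definition continuous_L2 (R : realType) (T : R) (u : R -> R -> R[i]) : Prop :=
  forall t : R, t \in `[0, T] ->
    L2 0 (2 * pi) (u t) /\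
    L2sqnorm 0 (2 * pi) (fun x => u s x - u t x)
      @[s --> within [set` `[0, T]] (nbhs t)] --> 0%E.

(* The mild solution of u_t - u_{5x} + u_{3x} + u_x = f(x) v(t), u(0) = u0, with
   periodic boundary conditions, on [0, T]:
   u(t) = S(t) u0 + \int_0^t v(s) S(t - s) f ds, S the group generated by A. *)
Definition is_solution (R : realType) (T : R) (f v u0 : R -> R[i])
    (u : R -> R -> R[i]) : Prop :=
  exists S : R -> (R -> R[i]) -> (R -> R[i]),
    [/\ generates (@opA R) S,
        continuous_L2 T u &
        forall t : R, t \in `[0, T] ->
          exists w, is_L2_integral t (fun s x => v s * S (t - s) f x) w /\
            L2eq 0 (2 * pi) (u t)
              (fun x => S t u0 x + w x)].

(* The sum of c_m zeta_m over m <> 0 is the L^2 limit g of its symmetric partial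
   sums; when the weight is infinite nothing is asserted. *)
Definition property_B (R : realType) (b : R) : Prop :=
  exists (T0 C : R) (zeta : int -> R -> R[i]),
    [/\ 2 * pi < T0, 0 < C,
        forall m, L2 (- (T0 / 2)) (T0 / 2) (zeta m),
        forall m n : int,
          cint (- (T0 / 2)) (T0 / 2)
            (fun t => zeta m t * cexp (eigval R n * real_complex R t))
          = (m == n)%:R &
        forall c : int -> R[i],
          let weight := (\esum_(m in [set m : int | m != 0%R])
            (normc (c m) ^+ 2 * expR (2 * b * m%:~R ^+ 6))%:E)%E in
          (weight < +oo)%E ->
          exists g : R -> R[i],
            [/\ L2 (- (T0 / 2)) (T0 / 2) g,
                L2sqnorm (- (T0 / 2)) (T0 / 2)
                  (fun t => \sum_(1 <= m < N.+1)
                      (c m%:Z * zeta m%:Z t + c (- m%:Z) * zeta (- m%:Z) t)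
                    - g t) @[N --> \oo] --> 0%E &
                (L2sqnorm (- (T0 / 2)) (T0 / 2) g <= C%:E * weight)%E]].

Definition tildeH (R : realType) (f : R -> R[i]) (beta : R) (h : R -> R[i]) :
    Prop :=
  L2 0 (2 * pi) h /\
  (\esum_(k in [set: int])
     (normc (fourier h k / fourier f k) ^+ 2
      * expR (beta * k%:~R ^+ 6))%:E < +oo)%E.

(* Main.v *)
From mathcomp Require Import all_boot all_order all_algebra.
From mathcomp Require Import ring lra complex.
From mathcomp Require Import all_classical all_reals all_analysis measurable_realfun.
Require Import Defs.

(** The exponentials exp(ikx) are eigenfunctions of the operator, which acts on
    them as multiplication by i freq(k), where freq(k) = k^5 + k^3 - k. The
    frequencies freq(k) are pairwise distinct integers. The functions
    exp(i freq(k) s) are therefore orthogonal on (0, 2 pi), and 2 pi is a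
    control time: by Duhamel's formula the k-th Fourier coefficient of u(2 pi)
    is exp(2 pi i freq(k)) (u0_k + 2 pi f_k v_freq(k)), so it suffices that the
    Fourier coefficient of v of index freq(k) be - u0_k / (2 pi f_k). These
    values are square summable, because exp(beta k^6) >= 1, and the
    Riesz-Fischer theorem provides v ([control_exists]). A function whose
    Fourier coefficients all vanish is zero, so u(2 pi) = 0
    ([solution_final_zero]).

    Three things have to be supplied around this argument.

    - Fourier theory in L^2(0, 2 pi): uniqueness of coefficients
      ([fourier_unique]), obtained by approximating indicators of intervals
      boundedly by trigonometric polynomials; the Riesz-Fischer theorem
      ([riesz_fischer_fourier]); Parseval's formulas ([parseval_sqnorm],
      [parseval_inner]).

    - The operator is a Fourier multiplier: opA h g holds exactly when
      g_k = i freq(k) h_k for all k ([opA_iff]). This rests on the fact that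
      smooth functions with compact support in (0, 2 pi) separate integrable
      functions ([test_function_separates]).

    - The group. The multiplier exp(i freq(k) t) defines a group generated by
      the operator ([evol_generates]), which yields a solution
      ([solution_exists]). Conversely any group generated by the operator acts
      on Fourier coefficients through this multiplier ([fourier_group]), so the
      computation above applies to every solution. *)

Set Implicit Arguments.
Unset Strict Implicit.
Unset Printing Implicit Defensive.
Import Order.TTheory GRing.Theory Num.Theory.
Import numFieldNormedType.Exports.
Import Normc.
Local Open Scope classical_set_scope.
Local Open Scope ring_scope.

(** * Complex numbers through real and imaginary parts *)

Section ComplexNumbers.
Context {R : realType}.
Implicit Types z w : R[i].
Local Notation Re := complex.Re.
Local Notation Im := complex.Im.

Lemma cReD z w : Re (z + w) = Re z + Re w. Proof. by case: z; case: w. Qed.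
Lemma cImD z w : Im (z + w) = Im z + Im w. Proof. by case: z; case: w. Qed.
Lemma cReN z : Re (- z) = - Re z. Proof. by case: z. Qed.
Lemma cImN z : Im (- z) = - Im z. Proof. by case: z. Qed.
Lemma cReM z w : Re (z * w) = Re z * Re w - Im z * Im w.
Proof. by case: z; case: w. Qed.
Lemma cImM z w : Im (z * w) = Re z * Im w + Im z * Re w.
Proof. by case: z => a b; case: w => c d /=. Qed.
Lemma cReconj z : Re (conjc z) = Re z. Proof. by case: z. Qed.
Lemma cImconj z : Im (conjc z) = - Im z. Proof. by case: z. Qed.
Definition ReImE := (cReD, cImD, cReN, cImN, cReM, cImM, cReconj, cImconj).

Lemma complexP z w : Re z = Re w -> Im z = Im w -> z = w.
Proof. by case: z => a b; case: w => c d /= -> ->. Qed.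

Lemma normcE z : normc z ^+ 2 = Re z ^+ 2 + Im z ^+ 2.
Proof. by case: z => a b /=; rewrite sqr_sqrtr// addr_ge0// sqr_ge0. Qed.

Lemma normc_ge0 z : 0 <= normc z.
Proof. by case: z => a b; exact: sqrtr_ge0. Qed.

Lemma normcD z w : normc (z + w) <= normc z + normc w.
Proof. by rewrite -lecR rmorphD; exact: (ler_normD z w). Qed.

Lemma normcN z : normc (- z) = normc z.
Proof. by case: z => a b /=; rewrite !sqrrN. Qed.

Lemma normcB z w : normc (z - w) = normc (w - z).
Proof. by rewrite -normcN opprB. Qed.

Lemma normc_conj z : normc (conjc z) = normc z.
Proof. by case: z => a b /=; rewrite sqrrN. Qed.

Lemma normcR (x : R) : normc (real_complex R x) = `|x|.
Proof. by rewrite /= expr0n addr0 sqrtr_sqr. Qed.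

Lemma Re_le_normc z : `|Re z| <= normc z.
Proof.
by case: z => a b /=; rewrite -sqrtr_sqr ler_wsqrtr// lerDl sqr_ge0.
Qed.

Lemma Im_le_normc z : `|Im z| <= normc z.
Proof.
by case: z => a b /=; rewrite -sqrtr_sqr ler_wsqrtr// lerDr sqr_ge0.
Qed.

Lemma normc_le_ReIm z : normc z <= `|Re z| + `|Im z|.
Proof.
have -> : z = real_complex R (Re z) + Complex 0 1 * real_complex R (Im z).
  exact: complexE.
rewrite (le_trans (normcD _ _))// normcM !normcR !ReImE /= expr0n expr1n add0r.
by rewrite sqrtr1 !(mul1r, mul0r, mulr0, subr0, addr0, add0r).
Qed.

Lemma normc_sum (I : Type) (s : seq I) (F : I -> R[i]) :
  normc (\sum_(i <- s) F i) <= \sum_(i <- s) normc (F i).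
Proof.
elim: s => [|i s ih]; first by rewrite !big_nil normc0.
by rewrite !big_cons (le_trans (normcD _ _))// lerD2l.
Qed.

Lemma normcX z n : normc (z ^+ n) = normc z ^+ n.
Proof. by elim: n => [|n ih]; rewrite ?normc1// !exprS normcM ih. Qed.

Lemma mul_conjc z : z * conjc z = real_complex R (normc z ^+ 2).
Proof.
by apply: complexP; rewrite !ReImE /= ?sqr_sqrtr ?addr_ge0 ?sqr_ge0// ?normcE;
  case: z => a b /=; ring.
Qed.

(** Arithmetic-geometric mean with a free weight, which replaces the
    Cauchy-Schwarz inequality throughout. *)
Lemma normcM_le z w (e : R) : 0 < e ->
  normc (z * w) <= (e * normc z ^+ 2 + e^-1 * normc w ^+ 2) / 2.
Proof.
move=> e0; rewrite normcM.
set x := normc z; set y := normc w.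
have -> : (e * x ^+ 2 + e^-1 * y ^+ 2) / 2
    = x * y + e^-1 * (e * x - y) ^+ 2 / 2 by field; rewrite gt_eqF.
by rewrite lerDl mulr_ge0 ?invr_ge0// mulr_ge0 ?sqr_ge0// invr_ge0 ltW.
Qed.

Lemma normc_sqrD z w : normc (z + w) ^+ 2 <= 2 * normc z ^+ 2 + 2 * normc w ^+ 2.
Proof.
rewrite !normcE !ReImE; set a := Re z; set b := Re w; set c := Im z; set d := Im w.
rewrite -subr_ge0 (_ : _ - _ = (a - b) ^+ 2 + (c - d) ^+ 2); last by ring.
by rewrite addr_ge0 ?sqr_ge0.
Qed.

Lemma conjcM z w : conjc (z * w) = conjc z * conjc w.
Proof. exact: rmorphM. Qed.
Lemma conjcK z : conjc (conjc z) = z.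
Proof. by apply: complexP; rewrite !ReImE ?opprK. Qed.
Lemma conjcR (x : R) : conjc (real_complex R x) = real_complex R x.
Proof. by rewrite /= oppr0. Qed.

End ComplexNumbers.

(** * Integrals of complex functions *)

Section ComplexIntegral.
Context {R : realType}.
Local Notation Re := complex.Re.
Local Notation Im := complex.Im.
Local Notation mu := (@lebesgue_measure R).
Implicit Types (a b : R) (h g k : R -> R[i]).

Definition cmeas (D : set R) h :=
  measurable_fun D (fun x => Re (h x)) /\ measurable_fun D (fun x => Im (h x)).

Section Measurability.
Variable D : set R.
Hypothesis mD : measurable D.

Lemma cmeas_cst (z : R[i]) : cmeas D (fun=> z).
Proof. by split; exact: measurable_cst. Qed.

Lemma cmeasD h g : cmeas D h -> cmeas D g -> cmeas D (fun x => h x + g x).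
Proof.
move=> [h1 h2] [g1 g2]; split.
  by under eq_fun do rewrite cReD; exact: measurable_funD.
by under eq_fun do rewrite cImD; exact: measurable_funD.
Qed.

Lemma cmeasM h g : cmeas D h -> cmeas D g -> cmeas D (fun x => h x * g x).
Proof.
move=> [h1 h2] [g1 g2]; split.
  by under eq_fun do rewrite cReM; apply: measurable_funB; exact: measurable_funM.
by under eq_fun do rewrite cImM; apply: measurable_funD; exact: measurable_funM.
Qed.

Lemma cmeas_conj h : cmeas D h -> cmeas D (fun x => conjc (h x)).
Proof.
move=> [h1 h2]; split.
  by under eq_fun do rewrite cReconj.
by under eq_fun do rewrite cImconj; exact: measurableT_comp.
Qed.

Lemma cmeas_real (p : R -> R) : measurable_fun D p ->
  cmeas D (fun x => real_complex R (p x)).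
Proof. by move=> mp; split => //=; exact: measurable_cst. Qed.

Lemma cmeasZ (z : R[i]) h : cmeas D h -> cmeas D (fun x => z * h x).
Proof. by move=> mh; apply: cmeasM => //; exact: cmeas_cst. Qed.

Lemma cmeasN h : cmeas D h -> cmeas D (fun x => - h x).
Proof.
move=> mh; rewrite (_ : (fun x => _) = (fun x => (-1) * h x)); first exact: cmeasZ.
by apply/funext => x; rewrite mulN1r.
Qed.

Lemma cmeasB h g : cmeas D h -> cmeas D g -> cmeas D (fun x => h x - g x).
Proof. by move=> mh mg; apply: cmeasD => //; exact: cmeasN. Qed.

Lemma measurable_normc2 h : cmeas D h ->
  measurable_fun D (fun x => normc (h x) ^+ 2).
Proof.
move=> [h1 h2]; under eq_fun do rewrite normcE.
by apply: measurable_funD; exact: measurable_funX.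
Qed.

Lemma measurable_normc h : cmeas D h -> measurable_fun D (fun x => normc (h x)).
Proof.
move=> mh; rewrite (_ : (fun x => _) =
    (fun x => Num.sqrt (normc (h x) ^+ 2))); last first.
  by apply/funext => x; rewrite sqrtr_sqr ger0_norm ?normc_ge0.
apply: (measurableT_comp (f := @Num.sqrt R)).
  by apply: continuous_measurable_fun; exact: sqrt_continuous.
exact: measurable_normc2.
Qed.

End Measurability.

Lemma cmeasS (D E : set R) h : measurable E -> D `<=` E -> cmeas E h ->
  cmeas D h.
Proof. by move=> mE DE [? ?]; split; exact: measurable_funS DE _. Qed.

Lemma continuous_cmeas (D : set R) h : measurable D ->
  continuous (fun x => Re (h x)) -> continuous (fun x => Im (h x)) ->
  cmeas D h.
Proof.
by move=> mD c1 c2; split; apply: (measurable_funS measurableT) => //;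
  exact: continuous_measurable_fun.
Qed.

Lemma itvoo_measurable a b : measurable (`]a, b[ : set R).
Proof. exact: measurable_itv. Qed.
Hint Resolve itvoo_measurable : core.

Lemma integrable_cst a b (c : R) : mu.-integrable `]a, b[ (EFin \o (fun=> c)).
Proof.
apply: measurable_bounded_integrable => //.
  rewrite /= lebesgue_measure_itv; case: ifP => // _.
  by rewrite -EFinB ltry.
by exists `|c|; split => // M cM x _; exact: ltW.
Qed.

Lemma integrable_addr a b (p q : R -> R) :
  mu.-integrable `]a, b[ (EFin \o p) -> mu.-integrable `]a, b[ (EFin \o q) ->
  mu.-integrable `]a, b[ (EFin \o (fun x => p x + q x)).
Proof. by move=> ip iq; apply: (integrableD _ ip iq). Qed.

Lemma integrable_mulr a b (c : R) (p : R -> R) :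
  mu.-integrable `]a, b[ (EFin \o p) ->
  mu.-integrable `]a, b[ (EFin \o (fun x => c * p x)).
Proof. by move=> ip; apply: (integrableZl _ c ip). Qed.

Lemma integrable_normr a b (p : R -> R) :
  mu.-integrable `]a, b[ (EFin \o p) ->
  mu.-integrable `]a, b[ (EFin \o (fun x => `|p x|)).
Proof. by move=> ip; exact: (integrable_norm ip). Qed.

Lemma cintegrable_le a b h (g : R -> R) : cmeas `]a, b[ h ->
  mu.-integrable `]a, b[ (EFin \o g) ->
  (forall x, x \in `]a, b[ -> normc (h x) <= g x) -> cintegrable a b h.
Proof.
move=> [h1 h2] ig hg; split; apply: le_integrable ig => //=.
- exact/measurable_EFinP.
- move=> x xab; rewrite lee_fin (le_trans (Re_le_normc _))//.
  by rewrite (le_trans (hg _ xab))// ler_norm.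
- exact/measurable_EFinP.
- move=> x xab; rewrite lee_fin (le_trans (Im_le_normc _))//.
  by rewrite (le_trans (hg _ xab))// ler_norm.
Qed.

Lemma cintegrable_cmeas a b h : cintegrable a b h -> cmeas `]a, b[ h.
Proof. by move=> [/measurable_int/measurable_EFinP ? /measurable_int/measurable_EFinP
  ?]. Qed.

Lemma cintegrable_normc a b h : cintegrable a b h ->
  mu.-integrable `]a, b[ (EFin \o (fun x => normc (h x))).
Proof.
move=> ih; have [mh1 mh2] := cintegrable_cmeas ih; case: ih => i1 i2.
have := integrable_addr (integrable_normr i1) (integrable_normr i2).
apply: le_integrable => //=.
  by apply/measurable_EFinP; exact: measurable_normc.
move=> x _; rewrite lee_fin ger0_norm ?normc_ge0// (le_trans (normc_le_ReIm _))//.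
exact: ler_norm.
Qed.

Lemma cintegrableD a b h g : cintegrable a b h -> cintegrable a b g ->
  cintegrable a b (fun x => h x + g x).
Proof.
move=> ih ig; apply: (@cintegrable_le _ _ _ (fun x => normc (h x) + normc (g x))).
- by apply: cmeasD; exact: cintegrable_cmeas.
- exact: integrable_addr (cintegrable_normc ih) (cintegrable_normc ig).
- by move=> x _; exact: normcD.
Qed.

Lemma cintegrableM_bounded a b h g (M : R) : cintegrable a b h ->
  cmeas `]a, b[ g -> (forall x, x \in `]a, b[ -> normc (g x) <= M) ->
  cintegrable a b (fun x => h x * g x).
Proof.
move=> ih mg gM; apply: (@cintegrable_le _ _ _ (fun x => M * normc (h x))).
- by apply: cmeasM => //; exact: cintegrable_cmeas.
- exact: integrable_mulr (cintegrable_normc ih).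
- by move=> x xab; rewrite normcM mulrC ler_wpM2r ?normc_ge0// gM.
Qed.

Lemma cintegrableZ a b (z : R[i]) h : cintegrable a b h ->
  cintegrable a b (fun x => z * h x).
Proof.
move=> ih; under eq_fun do rewrite mulrC.
by apply: (@cintegrableM_bounded _ _ _ _ (normc z)) => //; exact: cmeas_cst.
Qed.

Lemma cintegrable0 a b : cintegrable a b (fun=> 0).
Proof. by split; exact: integrable0. Qed.

Lemma cintegrable_sum a b (I : Type) (s : seq I) (F : I -> R -> R[i]) :
  (forall i, cintegrable a b (F i)) ->
  cintegrable a b (fun x => \sum_(i <- s) F i x).
Proof.
move=> iF; elim: s => [|i s ih].
  by under eq_fun do rewrite big_nil; exact: cintegrable0.
by under eq_fun do rewrite big_cons; exact: cintegrableD.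
Qed.

Lemma cintegrableS a b a' b' h : a <= a' -> b' <= b -> cintegrable a b h ->
  cintegrable a' b' h.
Proof.
move=> aa bb [h1 h2]; have S : `]a', b'[ `<=` (`]a, b[ : set R).
  by apply: subset_itv; rewrite bnd_simp.
split; [apply: (@integrableS _ _ _ mu _ _ _ _ _ S h1)|apply: (@integrableS _ _ _ mu _
  _ _ _ _ S h2)]; exact: measurable_itv.
Qed.

Lemma cintD a b h g : cintegrable a b h -> cintegrable a b g ->
  cint a b (fun x => h x + g x) = cint a b h + cint a b g.
Proof.
move=> [h1 h2] [g1 g2]; apply: complexP; rewrite !ReImE /cint /=.
  by rewrite -RintegralD//; apply: eq_Rintegral => x _; rewrite cReD.
by rewrite -RintegralD//; apply: eq_Rintegral => x _; rewrite cImD.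
Qed.

Lemma cintZ a b (z : R[i]) h : cintegrable a b h ->
  cint a b (fun x => z * h x) = z * cint a b h.
Proof.
move=> [h1 h2]; apply: complexP; rewrite !ReImE /cint /=.
  rewrite -!RintegralZl// -RintegralB//; [|exact: integrable_mulr..].
  by apply: eq_Rintegral => x _; rewrite cReM.
rewrite -!RintegralZl// -RintegralD//; [|exact: integrable_mulr..].
by apply: eq_Rintegral => x _; rewrite cImM.
Qed.

Lemma cint0 a b : cint a b (fun=> 0) = 0.
Proof. by apply: complexP; rewrite /cint /= /Rintegral integral0. Qed.

Lemma cint_sum a b (I : Type) (s : seq I) (F : I -> R -> R[i]) :
  (forall i, cintegrable a b (F i)) ->
  cint a b (fun x => \sum_(i <- s) F i x) = \sum_(i <- s) cint a b (F i).
Proof.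
move=> iF; elim: s => [|i s ih].
  by under eq_fun do rewrite big_nil; rewrite big_nil cint0.
under eq_fun do rewrite big_cons.
by rewrite big_cons cintD// ?ih//; exact: cintegrable_sum.
Qed.

Lemma cint_conj a b h : cintegrable a b h ->
  cint a b (fun x => conjc (h x)) = conjc (cint a b h).
Proof.
move=> [_ ih]; apply: complexP; rewrite ?ReImE /cint /=.
  by apply: eq_Rintegral => x _; rewrite cReconj.
rewrite /Rintegral -fineN; congr fine.
under eq_integral do rewrite cImconj EFinN.
by rewrite integralN//; exact: integrable_add_def.
Qed.

Lemma eq_cint a b h g : (forall x, x \in `]a, b[ -> h x = g x) ->
  cint a b h = cint a b g.
Proof.
move=> hg; congr Complex; apply: eq_Rintegral => x; rewrite inE => xab;
  by rewrite hg.
Qed.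

Lemma ae_imply (P Q : R -> Prop) : (forall x, P x -> Q x) ->
  {ae mu, forall x, P x} -> {ae mu, forall x, Q x}.
Proof. by move=> PQ; apply: (@filterS _ _ (ae_filter_ringOfSetsType mu)). Qed.

Lemma ae_imply2 (P Q S : R -> Prop) : (forall x, P x -> Q x -> S x) ->
  {ae mu, forall x, P x} -> {ae mu, forall x, Q x} -> {ae mu, forall x, S x}.
Proof. by move=> PQ; apply: (@filterS2 _ _ (ae_filter_ringOfSetsType mu)). Qed.

Lemma ae_eq_cint a b h g : cmeas `]a, b[ h -> cmeas `]a, b[ g ->
  L2eq a b h g -> cint a b h = cint a b g.
Proof.
move=> [h1 h2] [g1 g2] hg; congr Complex; congr fine;
  apply: ae_eq_integral => //=; try exact/measurable_EFinP;
  apply: ae_imply hg => x /= hg xab; congr EFin;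
  by rewrite hg.
Qed.

(** The factor 2 comes from bounding the real and imaginary parts separately. *)
Lemma normc_cint_le a b h (g : R -> R) : cintegrable a b h ->
  mu.-integrable `]a, b[ (EFin \o g) ->
  (forall x, x \in `]a, b[ -> normc (h x) <= g x) ->
  normc (cint a b h) <= 2 * \int[mu]_(x in `]a, b[) g x.
Proof.
move=> [h1 h2] ig hg; rewrite (le_trans (normc_le_ReIm _))// mulr2n mulrDl mul1r.
apply: lerD; rewrite /cint /= (le_trans (le_normr_Rintegral _ _))//;
  apply: le_Rintegral => //; try exact: integrable_norm.
- by move=> x /hg; apply: le_trans; exact: Re_le_normc.
- by move=> x /hg; apply: le_trans; exact: Im_le_normc.
Qed.

End ComplexIntegral.
#[local] Hint Resolve itvoo_measurable : core.

(** * Square-integrable functions *)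

Section SquareIntegrable.
Context {R : realType}.
Local Notation Re := complex.Re.
Local Notation Im := complex.Im.
Local Notation mu := (@lebesgue_measure R).
Implicit Types (a b : R) (h g k : R -> R[i]).

Lemma cvg_distP {T : Type} {F : set_system T} {FF : Filter F} (u : T -> R) l :
  u x @[x --> F] --> l <-> `|u x - l| @[x --> F] --> (0:R).
Proof.
split=> /cvgrPdist_le h; apply/cvgrPdist_le => e e0; move: (h e e0);
  apply: filterS => x; by rewrite sub0r normrN normr_id distrC.
Qed.

Lemma squeeze_cvg0 {T : Type} {F : set_system T} {FF : Filter F} (u w : T -> R) :
  (forall x, 0 <= u x <= w x) -> w x @[x --> F] --> (0:R) ->
  u x @[x --> F] --> (0:R).
Proof.
move=> uw cw; apply: (@squeeze_cvgr _ _ _ _ (fun=> 0) w) => //.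
  exact: nearW.
exact: cvg_cst.
Qed.

Definition sqnorm a b h : R := \int[mu]_(x in `]a, b[) (normc (h x) ^+ 2).

Lemma L2P a b h : L2 a b h <-> cmeas `]a, b[ h /\
  mu.-integrable `]a, b[ (EFin \o (fun x => normc (h x) ^+ 2)).
Proof.
have absE : L2sqnorm a b h =
    (\int[mu]_(x in `]a, b[) `|(normc (h x) ^+ 2)%:E|)%E.
  by apply: eq_integral => x _; rewrite gee0_abs// lee_fin sqr_ge0.
split=> [[h1 h2 hfin]|[[h1 h2] /integrableP[_ hfin]]].
  have mh : cmeas `]a, b[ h by split.
  split => //; apply/integrableP; split; last by rewrite -absE.
  by apply/measurable_EFinP; exact: measurable_normc2.
by split => //; rewrite absE.
Qed.

Lemma L2_cmeas a b h : L2 a b h -> cmeas `]a, b[ h.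
Proof. by case/L2P. Qed.

Lemma L2_integrable a b h : L2 a b h ->
  mu.-integrable `]a, b[ (EFin \o (fun x => normc (h x) ^+ 2)).
Proof. by case/L2P. Qed.
Arguments L2_integrable {a b h}.

Lemma L2sqnormE a b h : L2 a b h -> L2sqnorm a b h = (sqnorm a b h)%:E.
Proof.
move=> /L2_integrable ih; rewrite /sqnorm /Rintegral fineK//.
exact: integrable_fin_num.
Qed.

Lemma sqnorm_ge0 a b h : 0 <= sqnorm a b h.
Proof. by apply: Rintegral_ge0 => x _; exact: sqr_ge0. Qed.

Lemma L2_le a b h (p : R -> R) : cmeas `]a, b[ h ->
  mu.-integrable `]a, b[ (EFin \o p) ->
  (forall x, x \in `]a, b[ -> normc (h x) ^+ 2 <= p x) -> L2 a b h.
Proof.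
move=> mh ip hp; apply/L2P; split => //; apply: le_integrable ip => //=.
  by apply/measurable_EFinP; exact: measurable_normc2.
by move=> x /hp hx; rewrite lee_fin ger0_norm ?sqr_ge0// (le_trans hx)// ler_norm.
Qed.

Lemma L2D a b h g : L2 a b h -> L2 a b g -> L2 a b (fun x => h x + g x).
Proof.
move=> hh hg; apply: (@L2_le _ _ _
    (fun x => 2 * normc (h x) ^+ 2 + 2 * normc (g x) ^+ 2)).
- by apply: cmeasD => //; exact: L2_cmeas.
- by apply: integrable_addr; apply: integrable_mulr; exact: L2_integrable.
- by move=> x _; exact: normc_sqrD.
Qed.

Lemma L2M_bounded a b h g (M : R) : L2 a b h -> cmeas `]a, b[ g ->
  (forall x, x \in `]a, b[ -> normc (g x) <= M) ->
  L2 a b (fun x => g x * h x).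
Proof.
move=> hh mg gM; apply: (@L2_le _ _ _ (fun x => M ^+ 2 * normc (h x) ^+ 2)).
- by apply: cmeasM => //; exact: L2_cmeas.
- by apply: integrable_mulr; exact: L2_integrable.
- move=> x /gM hx; rewrite normcM exprMn ler_wpM2r ?sqr_ge0//.
  by rewrite ler_pXn2r// nnegrE ?normc_ge0// (le_trans (normc_ge0 _) hx).
Qed.

Lemma L2Z a b (z : R[i]) h : L2 a b h -> L2 a b (fun x => z * h x).
Proof.
by move=> hh; apply: (@L2M_bounded _ _ _ _ (normc z)) => //; exact: cmeas_cst.
Qed.

Lemma L2N a b h : L2 a b h -> L2 a b (fun x => - h x).
Proof.
by move=> /(L2Z (-1)); under eq_fun do rewrite mulN1r.
Qed.

Lemma L2B a b h g : L2 a b h -> L2 a b g -> L2 a b (fun x => h x - g x).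
Proof. by move=> hh hg; apply: L2D => //; exact: L2N. Qed.

Lemma L2_bounded a b h (M : R) : cmeas `]a, b[ h ->
  (forall x, x \in `]a, b[ -> normc (h x) <= M) -> L2 a b h.
Proof.
move=> mh hM; apply: (@L2_le _ _ _ (fun=> M ^+ 2)) => //.
  exact: integrable_cst.
move=> x /hM hx; rewrite ler_pXn2r// nnegrE ?normc_ge0//.
by rewrite (le_trans (normc_ge0 _) hx).
Qed.

Lemma L2_cst a b (z : R[i]) : L2 a b (fun=> z).
Proof. by apply: (@L2_bounded _ _ _ (normc z)) => //; exact: cmeas_cst. Qed.

Lemma L2_sum a b (I : Type) (s : seq I) (F : I -> R -> R[i]) :
  (forall i, L2 a b (F i)) -> L2 a b (fun x => \sum_(i <- s) F i x).
Proof.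
move=> iF; elim: s => [|i s ih].
  by under eq_fun do rewrite big_nil; exact: L2_cst.
by under eq_fun do rewrite big_cons; exact: L2D.
Qed.

Lemma L2_conj a b h : L2 a b h -> L2 a b (fun x => conjc (h x)).
Proof.
move=> hh; apply: (L2_le _ (L2_integrable hh)).
  by apply: cmeas_conj; exact: L2_cmeas.
by move=> x _; rewrite normc_conj.
Qed.

Lemma L2M_cintegrable a b h g : L2 a b h -> L2 a b g ->
  cintegrable a b (fun x => h x * g x).
Proof.
move=> hh hg; apply: (@cintegrable_le _ _ _ _
    (fun x => normc (h x) ^+ 2 + normc (g x) ^+ 2)).
- by apply: cmeasM => //; exact: L2_cmeas.
- by apply: integrable_addr; exact: L2_integrable.
- move=> x _; apply: (le_trans (normcM_le (h x) (g x) ltr01)).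
  rewrite invr1 !mul1r ler_pdivrMr// ler_peMr ?addr_ge0 ?sqr_ge0//.
  by rewrite (ler_nat _ 1 2).
Qed.

Lemma L2_cintegrable a b h : L2 a b h -> cintegrable a b h.
Proof.
move=> hh; have := L2M_cintegrable hh (L2_cst a b 1).
by under eq_fun do rewrite mulr1.
Qed.

Lemma L2S a b a' b' h : a <= a' -> b' <= b -> L2 a b h -> L2 a' b' h.
Proof.
move=> aa bb /L2P[mh ih]; have S : `]a', b'[ `<=` (`]a, b[ : set R).
  by apply: subset_itv; rewrite bnd_simp.
apply/L2P; split; first exact: cmeasS S mh.
by apply: (@integrableS _ _ _ mu _ _ _ _ _ S ih); exact: measurable_itv.
Qed.

Lemma L2inner_cintegrable a b h g : L2 a b h -> L2 a b g ->
  cintegrable a b (fun x => h x * conjc (g x)).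
Proof. by move=> hh hg; apply: L2M_cintegrable => //; exact: L2_conj. Qed.

Lemma L2innerDl a b h g k : L2 a b h -> L2 a b g -> L2 a b k ->
  L2inner a b (fun x => h x + g x) k = L2inner a b h k + L2inner a b g k.
Proof.
move=> hh hg hk; rewrite /L2inner -cintD; [|exact: L2inner_cintegrable..].
by apply: eq_cint => x _; rewrite mulrDl.
Qed.

Lemma L2innerZl a b z h k : L2 a b h -> L2 a b k ->
  L2inner a b (fun x => z * h x) k = z * L2inner a b h k.
Proof.
move=> hh hk; rewrite /L2inner -cintZ; last exact: L2inner_cintegrable.
by apply: eq_cint => x _; rewrite mulrA.
Qed.

Lemma L2innerBl a b h g k : L2 a b h -> L2 a b g -> L2 a b k ->
  L2inner a b (fun x => h x - g x) k = L2inner a b h k - L2inner a b g k.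
Proof.
move=> hh hg hk; rewrite -mulN1r -L2innerZl// -L2innerDl//; last exact: L2Z.
by under [in RHS]eq_fun do rewrite mulN1r.
Qed.

Lemma L2inner_suml a b (I : Type) (s : seq I) (F : I -> R -> R[i]) k :
  (forall i, L2 a b (F i)) -> L2 a b k ->
  L2inner a b (fun x => \sum_(i <- s) F i x) k
  = \sum_(i <- s) L2inner a b (F i) k.
Proof.
move=> iF hk; rewrite -cint_sum; last by move=> i; exact: L2inner_cintegrable.
by apply: eq_cint => x _; rewrite mulr_suml.
Qed.

Lemma L2innerC a b h g : L2 a b h -> L2 a b g ->
  L2inner a b g h = conjc (L2inner a b h g).
Proof.
move=> hh hg; rewrite -cint_conj; last exact: L2inner_cintegrable.
by apply: eq_cint => x _; rewrite conjcM conjcK mulrC.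
Qed.

Lemma L2inner_self a b h : L2 a b h ->
  L2inner a b h h = real_complex R (sqnorm a b h).
Proof.
move=> hh; apply: complexP; rewrite /L2inner /cint /=.
  by apply: eq_Rintegral => x _; rewrite mul_conjc.
rewrite (@eq_Rintegral _ _ _ mu _ (fun=> 0)); last first.
  by move=> x _; rewrite mul_conjc.
by rewrite /Rintegral integral0.
Qed.

Lemma ae_eq_L2inner a b h g k : L2 a b h -> L2 a b g -> L2 a b k ->
  L2eq a b h g -> L2inner a b h k = L2inner a b g k.
Proof.
move=> hh hg hk e; apply: ae_eq_cint.
- by apply: cintegrable_cmeas; exact: L2inner_cintegrable.
- by apply: cintegrable_cmeas; exact: L2inner_cintegrable.
- by apply: ae_imply e => x /= e xab; rewrite e.
Qed.

Lemma L2eq_sqnorm a b h g : L2 a b h -> L2 a b g -> L2eq a b h g ->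
  sqnorm a b h = sqnorm a b g.
Proof.
move=> hh hg e; congr fine; apply: ae_eq_integral => //=.
- by apply/measurable_EFinP; apply: measurable_normc2; exact: L2_cmeas.
- by apply/measurable_EFinP; apply: measurable_normc2; exact: L2_cmeas.
- by apply: ae_imply e => x /= e xab; rewrite e.
Qed.

Lemma L2eq_refl a b h : L2eq a b h h.
Proof. exact: aeW. Qed.

Lemma L2eq_trans a b g h k : L2eq a b h g -> L2eq a b g k -> L2eq a b h k.
Proof. by apply: ae_imply2 => x e1 e2 xab; rewrite e1// e2. Qed.

Lemma L2eqB a b h g h' g' : L2eq a b h h' -> L2eq a b g g' ->
  L2eq a b (fun x => h x - g x) (fun x => h' x - g' x).
Proof. by apply: ae_imply2 => x e1 e2 xab; rewrite e1// e2. Qed.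

Lemma sqnormD a b h g : L2 a b h -> L2 a b g ->
  sqnorm a b (fun x => h x + g x)
  = sqnorm a b h + sqnorm a b g + 2 * Re (L2inner a b h g).
Proof.
move=> hh hg.
have hD := L2D hh hg.
rewrite -[LHS]/(Re (real_complex R (sqnorm a b (fun x => h x + g x)))).
rewrite -L2inner_self//.
rewrite L2innerDl// (L2innerC hD hh) (L2innerC hD hg) !L2innerDl//.
rewrite (L2innerC hh hg) !L2inner_self// !ReImE /=; ring.
Qed.

Lemma sqnormZ a b z h : L2 a b h ->
  sqnorm a b (fun x => z * h x) = normc z ^+ 2 * sqnorm a b h.
Proof.
move=> hh; rewrite /sqnorm -RintegralZl//; last exact: L2_integrable.
by apply: eq_Rintegral => x _; rewrite normcM exprMn.
Qed.

Lemma sqnormN a b h : sqnorm a b (fun x => - h x) = sqnorm a b h.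
Proof. by apply: eq_Rintegral => x _; rewrite normcN. Qed.

Lemma sqnormD_le a b h g : L2 a b h -> L2 a b g ->
  sqnorm a b (fun x => h x + g x) <= 2 * sqnorm a b h + 2 * sqnorm a b g.
Proof.
move=> hh hg; have ih := L2_integrable hh; have ig := L2_integrable hg.
rewrite /sqnorm -!RintegralZl// -RintegralD//; [|exact: integrable_mulr..].
apply: le_Rintegral => //.
- exact: L2_integrable (L2D hh hg).
- by apply: integrable_addr; exact: integrable_mulr.
- by move=> x _; exact: normc_sqrD.
Qed.

(** A weighted substitute for the Cauchy-Schwarz inequality, strong enough
    for passing to the limit in an inner product. *)
Lemma L2inner_le a b h g (e : R) : L2 a b h -> L2 a b g -> 0 < e ->
  normc (L2inner a b h g) <= e * sqnorm a b h + e^-1 * sqnorm a b g.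
Proof.
move=> hh hg e0; have ih := L2_integrable hh; have ig := L2_integrable hg.
have iZh := integrable_mulr (e / 2) ih.
have iZg := integrable_mulr (e^-1 / 2) ig.
apply: (le_trans (normc_cint_le (g := fun x => e / 2 * normc (h x) ^+ 2
    + e^-1 / 2 * normc (g x) ^+ 2) _ _ _)).
- exact: L2inner_cintegrable.
- exact: integrable_addr.
- move=> x _; rewrite (le_trans (normcM_le (h x) (conjc (g x)) e0))//.
  by rewrite normc_conj mulrDl ![_ / 2 * _]mulrAC.
rewrite RintegralD// !RintegralZl// -!/(sqnorm a b _).
by set d := e^-1; lra.
Qed.

Lemma sqnorm_eq0 a b h : L2 a b h -> sqnorm a b h = 0 -> L2eq a b h (fun=> 0).
Proof.
move=> hh s0; have mh := L2_cmeas hh.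
have [+ _] := @ae_eq_integral_abs _ _ _ mu _ (measurable_itv `]a, b[) _
  ((measurable_EFinP _ _).2 (measurable_normc2 mh)).
rewrite (_ : (\int[_]_(_ in _) _)%E = L2sqnorm a b h); last first.
  by apply: eq_integral => x _ /=; rewrite ger0_norm ?sqr_ge0.
rewrite L2sqnormE// s0 => /(_ erefl).
apply: ae_imply => x /= e xab; have /= [] := e xab.
by move=> /eqP; rewrite sqrf_eq0 => /eqP/eq0_normc.
Qed.

(** Dominated convergence, stated through the modulus of the difference so that
    no topology on R[i] is involved. *)
Lemma cint_dominated a b (F : nat -> R -> R[i]) h (p : R -> R) :
  (forall n, cmeas `]a, b[ (F n)) ->
  mu.-integrable `]a, b[ (EFin \o p) ->
  (forall n x, x \in `]a, b[ -> normc (F n x) <= p x) ->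
  (forall x, x \in `]a, b[ -> normc (F n x - h x) @[n --> \oo] --> (0:R)) ->
  cintegrable a b h /\
  normc (cint a b (F n) - cint a b h) @[n --> \oo] --> (0:R).
Proof.
move=> mF ip Fp Fh.
have part (G : nat -> R -> R) (k : R -> R) :
    (forall n, measurable_fun `]a, b[ (G n)) ->
    (forall n x, x \in `]a, b[ -> `|G n x| <= p x) ->
    (forall x, x \in `]a, b[ -> `|G n x - k x| @[n --> \oo] --> (0:R)) ->
    mu.-integrable `]a, b[ (EFin \o k) /\
    `|\int[mu]_(x in `]a, b[) G n x - \int[mu]_(x in `]a, b[) k x|
      @[n --> \oo] --> (0:R).
  move=> mG Gp Gk.
  have Gk' x : x \in `]a, b[ -> G n x @[n --> \oo] --> k x.
    by move=> xab; apply/cvg_distP; exact: Gk.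
  have mk : measurable_fun `]a, b[ k.
    by apply: (measurable_fun_cvg mG) => x /= xab; exact: Gk'.
  have aek : {ae mu, forall x, `]a, b[%classic x ->
      (EFin \o G n) x @[n --> \oo] --> (EFin \o k) x}.
    apply: aeW => x xab; apply/fine_cvgP; split; first exact: nearW.
    exact: Gk'.
  have aeG : {ae mu, forall x n, `]a, b[%classic x ->
      (`|(EFin \o G n) x| <= (EFin \o p) x)%E}.
    by apply: aeW => x n xab; rewrite lee_fin Gp.
  have [ik _ cG] := @dominated_convergence _ _ _ mu _ (measurable_itv _)
    (fun n => EFin \o G n) (EFin \o k) (EFin \o p)
    (fun n => (measurable_EFinP _ _).2 (mG n)) ((measurable_EFinP _ _).2 mk)
    aek ip aeG.
  split => //; apply: (iffLR (cvg_distP _ _)).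
  have iG n : mu.-integrable `]a, b[ (EFin \o G n).
    apply: le_integrable ip => //=; first by apply/measurable_EFinP; exact: mG.
    by move=> x xab; rewrite lee_fin (le_trans (Gp n _ xab))// ler_norm.
  rewrite /Rintegral; apply: fine_cvg.
  rewrite fineK//; exact: integrable_fin_num.
have reF n x : x \in `]a, b[ -> `|Re (F n x)| <= p x.
  by move=> xab; rewrite (le_trans (Re_le_normc _))// Fp.
have imF n x : x \in `]a, b[ -> `|Im (F n x)| <= p x.
  by move=> xab; rewrite (le_trans (Im_le_normc _))// Fp.
have reh x : x \in `]a, b[ -> `|Re (F n x) - Re (h x)| @[n --> \oo] --> (0:R).
  move=> xab; apply: (squeeze_cvg0 _ (Fh x xab)) => n; rewrite normr_ge0/=.
  by have := Re_le_normc (F n x - h x); rewrite !ReImE.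
have imh x : x \in `]a, b[ -> `|Im (F n x) - Im (h x)| @[n --> \oo] --> (0:R).
  move=> xab; apply: (squeeze_cvg0 _ (Fh x xab)) => n; rewrite normr_ge0/=.
  by have := Im_le_normc (F n x - h x); rewrite !ReImE.
have [i1 c1] := part _ _ (fun n => (mF n).1) reF reh.
have [i2 c2] := part _ _ (fun n => (mF n).2) imF imh.
split; first by split.
apply: (@squeeze_cvg0 _ _ _ _ (fun n =>
    `|\int[mu]_(x in `]a, b[) Re (F n x) - \int[mu]_(x in `]a, b[) Re (h x)| +
    `|\int[mu]_(x in `]a, b[) Im (F n x) - \int[mu]_(x in `]a, b[) Im (h x)|)).
  by move=> n; rewrite normc_ge0 (le_trans (normc_le_ReIm _))// !ReImE.
rewrite -[X in _ --> X](addr0 (0:R)); exact: (cvgD c1 c2).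
Qed.

End SquareIntegrable.

(** * Exponentials and their orthogonality *)

Section Exponentials.
Context {R : realType}.
Local Notation Re := complex.Re.
Local Notation Im := complex.Im.
Local Notation mu := (@lebesgue_measure R).
Implicit Types (j k : int) (x y : R).

Definition expi j x : R[i] := Complex (cos (j%:~R * x)) (sin (j%:~R * x)).

Lemma normc_expi j x : normc (expi j x) = 1.
Proof. by rewrite /= cos2Dsin2 sqrtr1. Qed.

Lemma expi0 x : expi 0 x = 1.
Proof. by rewrite /expi mul0r cos0 sin0. Qed.

Lemma expiD j k x : expi (j + k) x = expi j x * expi k x.
Proof.
apply: complexP; rewrite ?ReImE /= rmorphD/= mulrDl ?cosD ?sinD//.
by rewrite addrC.
Qed.

Lemma expiN j x : expi (- j) x = conjc (expi j x).
Proof. by rewrite /expi /= rmorphN/= mulNr cosN sinN. Qed.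

Lemma expi_addr j x y : expi j (x + y) = expi j x * expi j y.
Proof.
apply: complexP; rewrite ?ReImE /= mulrDr ?cosD ?sinD//.
by rewrite addrC.
Qed.

Lemma expi_0r j : expi j 0 = 1.
Proof. by rewrite /expi mulr0 cos0 sin0. Qed.

Lemma expi_oppr j x : expi j (- x) = conjc (expi j x).
Proof. by rewrite /expi /= mulrN cosN sinN. Qed.

Lemma expi_conj j x : conjc (expi j x) * expi j x = 1.
Proof. by rewrite -expiN -expiD addNr expi0. Qed.

Lemma cexp_expi k x :
  cexp (- (Complex 0 1 * k%:~R * real_complex R x)) = conjc (expi k x).
Proof.
have -> : k%:~R = real_complex R k%:~R by rewrite rmorph_int.
have -> : - (Complex 0 1 * real_complex R k%:~R * real_complex R x)
    = Complex 0 (- (k%:~R * x)).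
  by apply: complexP; rewrite !ReImE /=; ring.
by rewrite /cexp /= expR0 cosN sinN mul1r.
Qed.

Lemma is_derive_mull (c x : R) : is_derive x 1 (fun y => c * y) c.
Proof.
have := @is_deriveZ _ _ _ (@id R) c x 1 1 (is_derive_id _ _).
by rewrite [_ *: _]mulr1.
Qed.

Lemma is_derive_cosM (c x : R) :
  is_derive x 1 (fun y => cos (c * y)) (- (c * sin (c * x))).
Proof.
have H := is_derive_mull c x.
have := @is_derive1_comp _ cos (fun y => c * y) x _ _ (is_derive_cos _) H.
by rewrite mulrC mulrN.
Qed.

Lemma is_derive_sinM (c x : R) :
  is_derive x 1 (fun y => sin (c * y)) (c * cos (c * x)).
Proof.
have H := is_derive_mull c x.
have := @is_derive1_comp _ sin (fun y => c * y) x _ _ (is_derive_sin _) H.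
by rewrite mulrC.
Qed.

Lemma is_derive_continuous (F f : R -> R) :
  (forall x, is_derive x 1 F (f x)) -> continuous F.
Proof.
move=> dF x; apply: differentiable_continuous; apply/derivable1_diffP.
by have [] := dF x.
Qed.

Lemma continuous_cosM c : continuous (fun y : R => cos (c * y)).
Proof. exact: is_derive_continuous (is_derive_cosM c). Qed.

Lemma continuous_sinM c : continuous (fun y : R => sin (c * y)).
Proof. exact: is_derive_continuous (is_derive_sinM c). Qed.

Lemma continuous_expi_Re j : continuous (fun x => Re (expi j x)).
Proof. exact: continuous_cosM. Qed.

Lemma continuous_expi_Im j : continuous (fun x => Im (expi j x)).
Proof. exact: continuous_sinM. Qed.

Lemma cmeas_expi (D : set R) j : measurable D -> cmeas D (expi j).
Proof.
by move=> mD; apply: continuous_cmeas => //;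
  [exact: continuous_expi_Re|exact: continuous_expi_Im].
Qed.

Lemma L2_expi a b j : L2 a b (expi j).
Proof.
by apply: (@L2_bounded _ _ _ _ 1) => [|x _]; [exact: cmeas_expi|rewrite normc_expi].
Qed.

Lemma Rintegral_FTC (F f : R -> R) a b : a < b ->
  (forall x, is_derive x 1 F (f x)) -> continuous f ->
  \int[mu]_(x in `]a, b[) f x = F b - F a.
Proof.
move=> ab dF cf; have cF := is_derive_continuous dF.
have icc : mu.-integrable `[a, b] (EFin \o f).
  apply: continuous_compact_integrable; first exact: segment_compact.
  exact: continuous_subspaceT.
have ioc : mu.-integrable `]a, b] (EFin \o f).
  apply: integrableS icc => //.
  by apply: subset_itvr; rewrite bnd_simp.
have ioo : mu.-integrable `]a, b[ (EFin \o f).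
  apply: integrableS icc => //.
  by apply: subset_itv; rewrite bnd_simp.
rewrite Rintegral_itv_bndo_bndc// Rintegral_itv_obnd_cbnd//.
rewrite /Rintegral (@continuous_FTC2 _ _ F)//.
- exact: continuous_subspaceT.
- split.
  + by move=> x _; have [] := dF x.
  + exact: cvg_at_right_filter (cF a).
  + exact: cvg_at_left_filter (cF b).
- by move=> x _; rewrite derive1E; have [_ ->] := dF x.
Qed.

Lemma tau_gt0 : 0 < 2 * pi :> R.
Proof. by rewrite mulr_gt0// pi_gt0. Qed.
Hint Resolve tau_gt0 : core.

Lemma cos_sin_period k : cos (k%:~R * (2 * pi) : R) = 1 /\
  sin (k%:~R * (2 * pi) : R) = 0.
Proof.
have nat_per (n : nat) : cos (n%:R * (2 * pi) : R) = 1 /\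
    sin (n%:R * (2 * pi) : R) = 0.
  elim: n => [|n [c s]]; first by rewrite mul0r cos0 sin0.
  rewrite -[n.+1]addn1 natrD mulrDl cosD sinD c s.
  have E : 2 * pi = pi *+ 2 :> R by rewrite mulr_natl.
  by rewrite !mul1r E cos2pi sin2pi !(mulr0, mul0r, mul1r, subr0, addr0).
case: k => n; first exact: nat_per.
have [c s] := nat_per n.+1.
by rewrite NegzE rmorphN/= mulNr cosN sinN c s oppr0.
Qed.

Lemma cint_expi j :
  cint 0 (2 * pi) (expi j) = real_complex R (2 * pi) * (j == 0)%:R.
Proof.
have [->|j0] := eqVneq j 0.
  rewrite mulr1 /cint /=; congr Complex.
    under eq_Rintegral do rewrite mul0r cos0.
    rewrite (Rintegral_FTC tau_gt0 (is_derive_mull 1)) ?mul1r ?subr0//.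
    by move=> x; exact: cvg_cst.
  under eq_Rintegral do rewrite mul0r sin0.
  by rewrite /Rintegral integral0.
have jR : j%:~R != 0 :> R by rewrite intr_eq0.
have [cp sp] := cos_sin_period j.
rewrite mulr0 /cint /=; congr Complex.
    have dF x : is_derive x 1 (fun y => j%:~R^-1 * sin (j%:~R * y)) (cos (j%:~R * x)).
    have := @is_deriveZ _ _ _ _ (j%:~R^-1) _ _ _ (is_derive_sinM j%:~R x).
    by rewrite [_ *: (_ * _)]mulrA mulVf// mul1r.
  rewrite (Rintegral_FTC tau_gt0 dF); last exact: continuous_cosM.
  by rewrite sp !mulr0 sin0 mulr0 subrr.
have dF x : is_derive x 1 (fun y => - j%:~R^-1 * cos (j%:~R * y)) (sin (j%:~R * x)).
  have := @is_deriveZ _ _ _ _ (- j%:~R^-1) _ _ _ (is_derive_cosM j%:~R x).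
  by rewrite [_ *: - (_ * _)]mulrNN mulrA mulVf// mul1r.
rewrite (Rintegral_FTC tau_gt0 dF); last exact: continuous_sinM.
by rewrite cp !mulr0 cos0 mulr1 subrr.
Qed.

Lemma L2inner_expi j k :
  L2inner 0 (2 * pi) (expi j) (expi k) = real_complex R (2 * pi) * (j == k)%:R.
Proof.
rewrite -subr_eq0 -cint_expi; apply: eq_cint => x _.
by rewrite -expiN -expiD.
Qed.

Lemma fourierE (h : R -> R[i]) k :
  fourier h k = real_complex R (2 * pi)^-1 * L2inner 0 (2 * pi) h (expi k).
Proof. by congr (_ * _); apply: eq_cint => x _; rewrite cexp_expi. Qed.

Lemma L2innerE (h : R -> R[i]) k :
  L2inner 0 (2 * pi) h (expi k) = real_complex R (2 * pi) * fourier h k.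
Proof.
by rewrite fourierE mulrA -rmorphM/= mulfV ?mul1r// gt_eqF.
Qed.

End Exponentials.
#[local] Hint Resolve tau_gt0 : core.

(** * Functions with vanishing integrals over intervals *)

Section FourierUniqueness.
Context {R : realType}.
Local Notation Re := complex.Re.
Local Notation Im := complex.Im.
Local Notation mu := (@lebesgue_measure R).

(** By Lebesgue differentiation: the primitive of f is constant on (a, b),
    and its derivative is f almost everywhere. *)
Lemma ae_eq0_of_Rintegral_itv (a b : R) (f : R -> R) :
  mu.-integrable `]a, b[ (EFin \o f) ->
  (forall c d, a < c -> c < d -> d < b -> \int[mu]_(x in `]c, d[) f x = 0) ->
  {ae mu, forall x, x \in `]a, b[ -> f x = 0}.
Proof.
move=> intf f0; set g := f \_ `]a, b[.
have locg : locally_integrable [set: R] g.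
  by apply: integrable_locally_restrict => //; exact: measurable_itv.
have gT : mu.-integrable setT (EFin \o g).
  rewrite /g -restrict_EFin; exact/(integrable_mkcond _ _).1.
have gS (A : set R) : measurable A -> mu.-integrable A (EFin \o g).
  by move=> mA; apply: integrableS gT.
have H0 := FTC1 (f := g) (a := BRight a) (fun y => gS _ (measurable_itv _)) locg.
apply: ae_imply H0 => x /= Hx; rewrite in_itv/= => /andP[ax xb].
have {Hx} [dF Fx] := Hx ltac:(by rewrite /= lte_fin).
have -> : f x = g x by rewrite /g patchE mem_set//= in_itv/= ax.
rewrite -Fx; set F := fun y => _.
have Fcst c d : a < c -> c < d -> d < b -> F d = F c.
  move=> ac cd db; apply/eqP; rewrite -subr_eq0 /F Rintegral_itvB ?bnd_simp//.
  - rewrite -Rintegral_itv_bndo_bndc; last exact: gS (measurable_itv _).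
    rewrite (@eq_Rintegral _ _ _ mu _ f) ?f0// => y; rewrite inE/= in_itv/=.
    move=> /andP[cy yd]; rewrite /g patchE mem_set//= in_itv/=.
    by rewrite (lt_trans ac cy) (lt_trans yd db).
  - exact: gS (measurable_itv _).
  - exact: ltW.
  - exact: ltW.
rewrite derive1E (@near_eq_derive _ _ _ F (cst (F x))) ?derive_cst//.
near=> y.
have ay : a < y by near: y; exact: lt_nbhsr.
have yb : y < b by near: y; exact: lt_nbhsl.
by have [xy|yx|->//] := ltgtP x y; [exact: Fcst|rewrite (Fcst y x)].
Unshelve. all: by end_near. Qed.

Lemma L2eq0_of_cint_itv (a b : R) (h : R -> R[i]) : cintegrable a b h ->
  (forall c d, a < c -> c < d -> d < b -> cint c d h = 0) ->
  L2eq a b h (fun=> 0).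
Proof.
move=> [h1 h2] h0.
have re0 := ae_eq0_of_Rintegral_itv h1
  (fun c d ac cd db => congr1 (@complex.Re R) (h0 c d ac cd db)).
have im0 := ae_eq0_of_Rintegral_itv h2
  (fun c d ac cd db => congr1 (@complex.Im R) (h0 c d ac cd db)).
by apply: ae_imply2 re0 im0 => x r i xab; apply: complexP; [exact: r|exact: i].
Qed.

Lemma cint_restrict (a b c d : R) (h : R -> R[i]) : a <= c -> d <= b ->
  cint c d h = cint a b (fun x => if x \in `]c, d[ then h x else 0).
Proof.
move=> ac db.
have E (p : R -> R) : \int[mu]_(x in `]c, d[) p x
    = \int[mu]_(x in `]a, b[) (if x \in `]c, d[ then p x else 0).
  rewrite -(_ : `]a, b[%classic `&` `]c, d[%classic = `]c, d[%classic); last first.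
    apply/setIidr; apply: subset_itv; rewrite bnd_simp//.
  rewrite Rintegral_mkcondr; apply: eq_Rintegral => x _; rewrite patchE.
  by rewrite (_ : (x \in `]c, d[%classic) = (x \in `]c, d[))//;
    apply/idP/idP => [/set_mem|/mem_set].
by rewrite /cint !E; congr Complex; apply: eq_Rintegral => x _; case: ifP.
Qed.

End FourierUniqueness.

(** * Uniqueness of Fourier coefficients *)

Section TrigonometricKernel.
Context {R : realType}.
Local Notation Re := complex.Re.
Local Notation Im := complex.Im.
Local Notation mu := (@lebesgue_measure R).
Local Notation tau := (2 * pi).

Lemma bernoulli_ge (t : R) N : 0 <= t <= 1 -> 1 - N%:R * t <= (1 - t) ^+ N.
Proof.
move=> /andP[t0 t1]; elim: N => [|N ih]; first by rewrite mul0r subr0 expr0.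
rewrite exprS; have h1 : (1 - t) * (1 - N%:R * t) <= (1 - t) * (1 - t) ^+ N.
  by rewrite ler_wpM2l// subr_ge0.
apply: le_trans h1; rewrite -subr_ge0 -natr1.
rewrite (_ : _ - _ = N%:R * t ^+ 2); last by ring.
by rewrite mulr_ge0 ?sqr_ge0.
Qed.

Lemma bernoulli_le (t : R) N : 0 <= t <= 1 -> (1 - t) ^+ N * (1 + N%:R * t) <= 1.
Proof.
move=> /andP[t0 t1]; elim: N => [|N ih]; first by rewrite mul0r addr0 expr0 mulr1.
apply: le_trans ih; rewrite exprSr -mulrA ler_wpM2l// ?exprn_ge0 ?subr_ge0//.
rewrite -subr_ge0 -natr1.
rewrite (_ : _ - _ = (N%:R + 1) * t ^+ 2); last by ring.
by rewrite mulr_ge0 ?sqr_ge0 ?addr_ge0.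
Qed.

(** The polynomials of the classical proof of the Stone-Weierstrass theorem:
    they tend to 1 left of 1/2 and to 0 right of it, within [0, 1]. *)
Definition step (n : nat) (t : R) := (1 - t ^+ n) ^+ (2 ^ n).

Lemma step01 n t : 0 <= t <= 1 -> 0 <= step n t <= 1.
Proof.
move=> /andP[t0 t1]; have h0 : 0 <= 1 - t ^+ n by rewrite subr_ge0 exprn_ile1.
by rewrite /step exprn_ge0//= exprn_ile1// gerBl exprn_ge0.
Qed.

Lemma step_cvg1 t : 0 <= t < 1 / 2 -> `|step n t - 1| @[n --> \oo] --> (0:R).
Proof.
move=> /andP[t0 t2]; have t1 : t <= 1 by lra.
apply: (@squeeze_cvg0 _ _ _ _ _ (fun n => (2 * t) ^+ n)).
  move=> n; rewrite normr_ge0/=.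
  have /andP[_ s1] := @step01 n t ltac:(by rewrite t0 t1).
  rewrite ler0_norm ?subr_le0// opprB lerBlDr -lerBlDl exprMn -natrX.
  by apply: bernoulli_ge; rewrite exprn_ge0//= exprn_ile1.
by apply: cvg_expr; rewrite ger0_norm; lra.
Qed.

Lemma step_cvg0 t : 1 / 2 < t <= 1 -> `|step n t - 0| @[n --> \oo] --> (0:R).
Proof.
move=> /andP[t2 t1]; have t0 : 0 < t by lra.
apply: (@squeeze_cvg0 _ _ _ _ _ (fun n => (2 * t)^-1 ^+ n)).
  move=> n; rewrite normr_ge0/= subr0.
  have /andP[s0 _] := @step01 n t ltac:(by rewrite t1 ltW).
  rewrite ger0_norm// exprVn -[leRHS]div1r ler_pdivlMr; last first.
    by rewrite exprn_gt0// mulr_gt0.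
  have t0' := ltW t0.
  have := @bernoulli_le (t ^+ n) (2 ^ n) ltac:(by rewrite exprn_ge0//= exprn_ile1).
  apply: le_trans; rewrite ler_wpM2l// natrX -exprMn lerDr//.
apply: cvg_expr; rewrite ger0_norm ?invr_ge0; last by lra.
by rewrite invf_lt1; lra.
Qed.

Section Annihilated.
Variable h : R -> R[i].
Hypothesis ih : cintegrable 0 tau h.
Hypothesis h0 : forall j, cint 0 tau (fun x => h x * expi j x) = 0.

(** Bounded multipliers p such that p h has no Fourier coefficients either. *)
Definition annihilator (p : R -> R) := [/\ measurable_fun setT p,
  exists M, forall x, `|p x| <= M &
  forall j, cint 0 tau (fun x => real_complex R (p x) * (h x * expi j x)) = 0].

Lemma annihilator_int p j : annihilator p ->
  cintegrable 0 tau (fun x => real_complex R (p x) * (h x * expi j x)).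
Proof.
move=> [mp [M pM] _]; under eq_fun do rewrite mulrC.
apply: (@cintegrableM_bounded _ _ _ _ _ M).
- apply: (@cintegrableM_bounded _ _ _ _ _ 1) => //; first exact: cmeas_expi.
  by move=> x _; rewrite normc_expi.
- apply: cmeas_real; apply: measurable_funS mp => //.
- by move=> x _; rewrite normcR.
Qed.

Lemma annihilator1 : annihilator (fun=> 1).
Proof.
split; [exact: measurable_cst|by exists 1 => x; rewrite normr1|].
by move=> j; under eq_fun do rewrite mul1r.
Qed.

Lemma annihilatorB p q : annihilator p -> annihilator q ->
  annihilator (fun x => p x - q x).
Proof.
move=> hp hq; case: (hp) (hq) => [mp [M pM] p0] [mq [N qN] q0].
split; first exact: measurable_funB.
  by exists (M + N) => x; rewrite (le_trans (ler_normB _ _))// lerD.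
move=> j; under eq_fun do rewrite rmorphB/= mulrBl -mulN1r.
rewrite cintD ?cintZ; [|exact: annihilator_int..|].
  by rewrite p0 q0 mulr0 addr0.
by apply: cintegrableZ; exact: annihilator_int.
Qed.

(** Multiplying by a trigonometric polynomial of degree one only shifts the
    frequencies. *)
Lemma annihilatorM p (q : R -> R) (al be ga : R[i]) : annihilator p ->
  continuous q -> (forall x, 0 <= q x <= 1) ->
  (forall x, real_complex R (q x) = al + be * expi 1 x + ga * expi (-1) x) ->
  annihilator (fun x => q x * p x).
Proof.
move=> hp cq q01 qE; case: (hp) => [mp [M pM] p0].
split; first by apply: measurable_funM => //; exact: continuous_measurable_fun.
  exists M => x; have /andP[q0 q1] := q01 x.
  rewrite normrM (ger0_norm q0) (le_trans _ (pM x))//.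
  by rewrite ler_piMl.
move=> j; rewrite (@eq_cint _ _ _ _ (fun x =>
    (al * (real_complex R (p x) * (h x * expi j x)) +
     be * (real_complex R (p x) * (h x * expi (1 + j) x))) +
     ga * (real_complex R (p x) * (h x * expi (-1 + j) x)))); last first.
  by move=> x _; rewrite rmorphM/= qE !expiD; ring.
have ip k := annihilator_int k hp.
rewrite cintD; [|apply: cintegrableD; exact: cintegrableZ|exact: cintegrableZ].
rewrite cintD; [|exact: cintegrableZ..].
by rewrite !cintZ// !p0 !mulr0 !addr0.
Qed.

Lemma annihilator_step (q : R -> R) (al be ga : R[i]) n :
  continuous q -> (forall x, 0 <= q x <= 1) ->
  (forall x, real_complex R (q x) = al + be * expi 1 x + ga * expi (-1) x) ->
  annihilator (fun x => step n (q x)).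
Proof.
move=> cq q01 qE.
have M p m : annihilator p -> annihilator (fun x => q x ^+ m * p x).
  move=> hp; elim: m => [|m ihm]; first by under eq_fun do rewrite mul1r.
  by under eq_fun do rewrite exprS -mulrA; exact: annihilatorM qE.
have {}M p m : annihilator p -> annihilator (fun x => (1 - q x ^+ m) * p x).
  move=> hp; under eq_fun do rewrite mulrBl mul1r.
  by apply: annihilatorB => //; exact: M.
rewrite /step; elim: (2 ^ n)%N => [|m ihm]; first exact: annihilator1.
by under eq_fun do rewrite exprS; exact: M.
Qed.

Section Interval.
Variables c d : R.
Hypothesis c0 : 0 < c.
Hypothesis cd : c < d.
Hypothesis dt : d < tau.
Let m := (c + d) / 2.
Let r := (d - c) / 2.

(** A trigonometric polynomial with values in [0, 1] which is below 1/2 on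
    (c, d) and above 1/2 outside [c, d]. *)
Definition bump x := 1 / 2 + (cos r - cos (x - m)) / 4.

Lemma bump01 x : 0 <= bump x <= 1.
Proof.
rewrite /bump; have := cos_le1 r; have := cos_geN1 r.
have := cos_le1 (x - m); have := cos_geN1 (x - m).
by move=> *; apply/andP; split; lra.
Qed.

Lemma midpoint_radius : [/\ m - r = c, m + r = d, 0 < r & r < pi].
Proof. by move: c0 cd dt => *; rewrite /m /r; split; lra. Qed.

Lemma bump_in x : c < x -> x < d -> bump x < 1 / 2.
Proof.
have [<- <- r0 rpi] := midpoint_radius => cx xd.
suff : cos r < cos (x - m) by rewrite /bump => ?; lra.
rewrite -(cos_norm (x - m)); have xr : `|x - m| < r.
  by rewrite ltr_norml; apply/andP; split; lra.
rewrite ltr_cos// in_itv/= ?normr_ge0/=; last by rewrite !ltW.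
by rewrite ltW// (lt_trans xr).
Qed.

Lemma bump_out x : 0 < x -> x < tau -> x < c \/ d < x -> 1 / 2 < bump x.
Proof.
move: c0 dt; have [<- <- r0 rpi] := midpoint_radius => mr0 mrt x0 xt xcd.
suff : cos (x - m) < cos r by rewrite /bump => ?; lra.
have cosr y : r < y -> y < tau - r -> cos y < cos r.
  move=> ry yt; have rI : r \in `[0, pi] by rewrite in_itv/= !ltW.
  have [ypi|ypi] := leP y pi.
    by rewrite ltr_cos// in_itv/= ypi andbT; lra.
  have -> : cos y = cos (tau - y).
    rewrite cosB -[tau]mul1r; have [] := @cos_sin_period R 1.
    by rewrite mulr1z => -> ->; rewrite mul1r mul0r addr0.
  rewrite ltr_cos//; first by lra.
  by rewrite in_itv/=; apply/andP; split; lra.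
rewrite -(cos_norm (x - m)).
have [mx|xm] := leP m x; [rewrite ger0_norm ?subr_ge0//|rewrite ltr0_norm ?subr_lt0//];
  by apply: cosr; case: xcd => ?; lra.
Qed.

Lemma continuous_bump : continuous bump.
Proof.
move=> x; apply: cvgD; first exact: cvg_cst.
apply: cvgMl; apply: cvgB; first exact: cvg_cst.
apply: (@continuous_comp _ _ _ (fun x => x - m) cos); last exact: continuous_cos.
by apply: cvgB; [exact: cvg_id|exact: cvg_cst].
Qed.

Lemma bumpE x : real_complex R (bump x) = real_complex R (1 / 2 + cos r / 4)
  + (- real_complex R (8^-1) * conjc (expi 1 m)) * expi 1 x
  + (- real_complex R (8^-1) * expi 1 m) * expi (-1) x.
Proof.
rewrite expiN; apply: complexP; rewrite !ReImE /= !mul1r.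
  by rewrite /bump cosB; field.
by ring.
Qed.

(** The functions step n (bump x) are trigonometric polynomials, so their
    products with h have integral 0; they tend boundedly to the indicator of
    (c, d) away from the endpoints. *)
Lemma cint_eq0_of_annihilated : cint c d h = 0.
Proof.
(* At c and d the polynomials have another limit, so h is made to vanish there. *)
pose h' x := if (x == c) || (x == d) then 0 else h x.
have negl (e : R) : {ae mu, forall x, x != e}.
  exists [set e]; split => //; first exact: lebesgue_measure_set1.
  by move=> x /= /negP; rewrite negbK => /eqP.
have hh' : {ae mu, forall x, h x = h' x}.
  by apply: ae_imply2 (negl c) (negl d) => x /negPf xc /negPf xd; rewrite /h' xc xd.
have mh := cintegrable_cmeas ih.
have mh' : cmeas `]0, tau[ h'.
  rewrite (_ : h' = fun x => h x * real_complex R (1 - \1_([set c] `|` [set d]) x)).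
    apply: cmeasM => //; apply: cmeas_real; apply: measurable_funB => //.
    by apply: measurable_indic; exact: measurableU.
  apply/funext => x; rewrite /h' indicE.
  have [->|xc] := eqVneq x c.
    by rewrite mem_set/= ?subrr ?mulr0//; left.
  have [->|xd] := eqVneq x d.
    by rewrite mem_set/= ?subrr ?mulr0//; right.
  by rewrite memNset/= ?subr0 ?mulr1// => -[] /eqP; apply/negP.
pose F n x := real_complex R (step n (bump x)) * h' x.
have aF n : annihilator (fun x => step n (bump x)).
  exact: (annihilator_step _ continuous_bump bump01 bumpE).
have mF n : cmeas `]0, tau[ (F n).
  apply: cmeasM => //; apply: cmeas_real; have [mp _ _] := aF n.
  exact: measurable_funS mp.
have F0 n : cint 0 tau (F n) = 0.
  have [_ _ /(_ 0)] := aF n; apply: etrans; apply: ae_eq_cint => //.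
    by apply: cintegrable_cmeas; exact: annihilator_int.
  by apply: ae_imply hh' => x /= e _; rewrite expi0 mulr1 /F e.
have hF n x : x \in `]0, tau[ -> normc (F n x) <= normc (h x).
  move=> _; rewrite normcM normcR; have /andP[s0 s1] := step01 n (bump01 x).
  rewrite ger0_norm// (@le_trans _ _ (1 * normc (h' x)))//.
    by rewrite ler_wpM2r// normc_ge0.
  by rewrite mul1r /h'; case: ifP => //; rewrite normc0 normc_ge0.
have Fh x : x \in `]0, tau[ ->
    normc (F n x - (if x \in `]c, d[ then h' x else 0)) @[n --> \oo] --> (0:R).
  rewrite in_itv/= => /andP[x0 xt].
  have E (l : R) v : v = real_complex R l * h' x ->
      `|step n (bump x) - l| @[n --> \oo] --> (0:R) ->
      normc (F n x - v) @[n --> \oo] --> (0:R).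
    move=> -> cl; under eq_fun do rewrite /F -mulrBl normcM -rmorphB normcR.
    by rewrite -(mul0r (normc (h' x))); apply: cvgM => //; exact: cvg_cst.
  have /andP[b0 b1] := bump01 x.
  case: ifPn => [|xcd].
    rewrite in_itv/= => /andP[cx xd]; apply: (E 1); first by rewrite mul1r.
    by apply: step_cvg1; rewrite b0 bump_in.
  have [xcd'|] := boolP ((x == c) || (x == d)).
    have h'x0 : h' x = 0 by rewrite /h' xcd'.
    by rewrite /F h'x0; under eq_fun do rewrite mulr0 subrr normc0; exact: cvg_cst.
  rewrite negb_or => /andP[xc xd]; apply: (E 0); first by rewrite mul0r.
  apply: step_cvg0; rewrite b1 andbT bump_out//.
  move: xcd; rewrite in_itv/= negb_and -!leNgt !le_eqVlt (negPf xc) [d == x]eq_sym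
    (negPf xd).
  by move=> /orP.
have [_] := cint_dominated mF (cintegrable_normc ih) hF Fh.
under eq_fun do rewrite F0 sub0r normcN.
move=> /cvg_lim; rewrite lim_cst// => /(_ (@Rhausdorff R)) /eq0_normc.
rewrite -cint_restrict ?ltW// => <-; apply: eq_cint => x;
  rewrite in_itv/= => /andP[cx xd].
by rewrite /h' gt_eqF//= lt_eqF.
Qed.

End Interval.
End Annihilated.

(** Trigonometric polynomials approximate the indicators of intervals, hence h
    has integral 0 over every interval. *)
Lemma fourier_unique0 (h : R -> R[i]) : cintegrable 0 tau h ->
  (forall k, fourier h k = 0) -> L2eq 0 tau h (fun=> 0).
Proof.
move=> ih h0; apply: L2eq0_of_cint_itv => // c d c0 cd dt.
apply: (cint_eq0_of_annihilated ih) => // j.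
have := L2innerE h (- j); rewrite h0 mulr0 => <-.
by apply: eq_cint => x _; rewrite -expiN opprK.
Qed.

Lemma fourierB (h g : R -> R[i]) k : L2 0 tau h -> L2 0 tau g ->
  fourier (fun x => h x - g x) k = fourier h k - fourier g k.
Proof.
by move=> hh hg; rewrite !fourierE L2innerBl//; [rewrite mulrBr|exact: L2_expi].
Qed.

Lemma fourierD (h g : R -> R[i]) k : L2 0 tau h -> L2 0 tau g ->
  fourier (fun x => h x + g x) k = fourier h k + fourier g k.
Proof.
by move=> hh hg; rewrite !fourierE L2innerDl//; [rewrite mulrDr|exact: L2_expi].
Qed.

Lemma fourierZ (z : R[i]) (h : R -> R[i]) k : L2 0 tau h ->
  fourier (fun x => z * h x) k = z * fourier h k.
Proof.
by move=> hh; rewrite !fourierE L2innerZl//; [rewrite mulrCA|exact: L2_expi].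
Qed.

Lemma fourier_expi j k : fourier (@expi R j) k = (j == k)%:R.
Proof.
rewrite fourierE L2inner_expi mulrA -rmorphM mulVf; last exact: lt0r_neq0 tau_gt0.
exact: mul1r.
Qed.

Lemma L2eq_fourier (h g : R -> R[i]) k : L2 0 tau h -> L2 0 tau g ->
  L2eq 0 tau h g -> fourier h k = fourier g k.
Proof.
move=> hh hg e; rewrite !fourierE (ae_eq_L2inner hh hg _ e)//.
exact: L2_expi.
Qed.

Lemma fourier_unique (h g : R -> R[i]) : L2 0 tau h -> L2 0 tau g ->
  (forall k, fourier h k = fourier g k) -> L2eq 0 tau h g.
Proof.
move=> hh hg e.
have h0 : L2eq 0 tau (fun x => h x - g x) (fun=> 0).
  apply: fourier_unique0; first by apply: L2_cintegrable; exact: L2B.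
  by move=> k; rewrite fourierB// e subrr.
by apply: ae_imply h0 => x /= e0 /e0/eqP; rewrite subr_eq0 => /eqP.
Qed.

End TrigonometricKernel.

(** * Series of nonnegative terms *)

Section BoundedSeries.
Context {R : realType}.
Implicit Types u w : nat -> R.

(** For a nonnegative sequence this is summability. *)
Definition bsum u := exists B, forall n, \sum_(0 <= i < n) u i <= B.

Lemma bsum_le u w : (forall i, u i <= w i) -> bsum w -> bsum u.
Proof.
move=> uw [B Bw]; exists B => n; apply: le_trans (Bw n).
by apply: ler_sum => i _.
Qed.

Lemma bsumD u w : bsum u -> bsum w -> bsum (fun i => u i + w i).
Proof. by move=> [B Bu] [C Cw]; exists (B + C) => n; rewrite big_split/= lerD. Qed.

Lemma bsumZ (c : R) u : 0 <= c -> bsum u -> bsum (fun i => c * u i).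
Proof.
by move=> c0 [B Bu]; exists (c * B) => n; rewrite -mulr_sumr ler_wpM2l.
Qed.

Lemma bsum_tail u : (forall i, 0 <= u i) -> bsum u -> forall e, 0 < e ->
  exists N, forall m n, (N <= m)%N -> \sum_(m <= i < n) u i <= e.
Proof.
move=> u0 [B Bu] e e0; pose S n := \sum_(0 <= i < n) u i.
have ndS : {homo S : m n / (m <= n)%N >-> m <= n}.
  move=> m n mn; rewrite /S (big_cat_nat _ mn)//= lerDl.
  by apply: sumr_ge0.
have hsup : has_sup (range S).
  split; first by exists (S 0%N); exists 0%N.
  by exists B => _ [n _ <-]; exact: Bu.
have [_ [N _ <-] hN] := sup_adherent e0 hsup.
exists N => m n Nm; have [mn|nm] := leqP m n; last first.
  by rewrite big_geq ?ltW// ltnW.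
have : S n <= sup (range S) by apply: sup_upper_bound => //; exists n.
have : S N <= S m by exact: ndS.
have : S n = S m + \sum_(m <= i < n) u i by rewrite /S (big_cat_nat _ mn).
by move=> *; lra.
Qed.

Lemma bsum_esum (u : int -> R) (z : nat -> int) : bijective z ->
  (forall k, 0 <= u k) ->
  (\esum_(k in [set: int]) (u k)%:E < +oo)%E <-> bsum (u \o z).
Proof.
move=> bz u0.
have nn i : (0 <= (u (z i))%:E)%E by rewrite lee_fin.
have -> : (\esum_(k in [set: int]) (u k)%:E = \sum_(i <oo) (u (z i))%:E)%E.
  rewrite (reindex_esum [set: nat] _ z)//; first by rewrite nneseries_esumT.
  split => //; first by move=> i j _ _; exact: bij_inj.
  by move=> k _; case: bz => z' _ zK; exists (z' k).
split=> [fin|[B hB]].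
  exists (fine (\sum_(i <oo) (u (z i))%:E)%E) => n.
  rewrite -lee_fin fineK; last by rewrite ge0_fin_numE// nneseries_ge0.
  by rewrite -sumEFin; apply: nneseries_lim_ge => i _ _; exact: nn.
apply: (@le_lt_trans _ _ B%:E); last exact: ltry.
apply: lime_le; first exact: is_cvg_nneseries.
by apply: nearW => n; rewrite sumEFin lee_fin.
Qed.

(** Dominated convergence for series: the tails of the a t are uniformly small,
    and each head is a finite sum. *)
Lemma bsum_dominated {T : Type} {F : set_system T} {FF : Filter F}
    (a : T -> nat -> R) (B : nat -> R) (s : T -> R) :
  (forall t i, 0 <= a t i) -> (forall i, 0 <= B i) -> bsum B ->
  (\forall t \near F, forall i, a t i <= B i) ->
  (forall i, a t i @[t --> F] --> (0:R)) ->
  (forall t, \sum_(0 <= i < n) a t i @[n --> \oo] --> s t) ->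
  s t @[t --> F] --> (0:R).
Proof.
move=> a0 B0 bB aB ai0 sE; apply/cvgrPdist_le => e e0.
have e20 : 0 < e / 2 by rewrite divr_gt0.
have [N hN] := bsum_tail B0 bB e20.
have cN : (\sum_(0 <= i < N) a t i) @[t --> F] --> (0:R).
  elim: N {hN} => [|N ih]; first by under eq_fun do rewrite big_geq//; exact: cvg_cst.
  under eq_fun do rewrite big_nat_recr//=.
  by have := cvgD ih (ai0 N); rewrite addr0; apply.
move/cvgrPdist_le : cN => /(_ _ e20) cN.
apply: filterS2 aB cN => t aBt; rewrite sub0r normrN => head.
have st0 : 0 <= s t.
  rewrite -(cvg_lim (@Rhausdorff R) (sE t)); apply: limr_ge.
    by apply: cvgP; exact: sE.
  by apply: nearW => n; exact: sumr_ge0.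
rewrite sub0r normrN ger0_norm//.
rewrite -(cvg_lim (@Rhausdorff R) (sE t)); apply: limr_le.
  by apply: cvgP; exact: sE.
exists N => // n /= Nn; rewrite (big_cat_nat _ Nn)//= (splitr e) lerD//.
  exact: le_trans (ler_norm _) head.
by apply: le_trans (hN N n (leqnn N)); exact: ler_sum.
Qed.

End BoundedSeries.

(** * The Riesz-Fischer theorem *)

Section RieszFischer.
Context {R : realType}.
Local Notation Re := complex.Re.
Local Notation Im := complex.Im.
Local Notation mu := (@lebesgue_measure R).
Local Notation tau := (2 * pi).
Implicit Types (h g : R -> R[i]).

Lemma L2inner_cvg0 (a b : R) {T : Type} {F : set_system T} {FF : Filter F}
    (r : T -> R -> R[i]) g :
  (forall t, L2 a b (r t)) -> L2 a b g -> sqnorm a b (r t) @[t --> F] --> (0:R) ->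
  normc (L2inner a b (r t) g) @[t --> F] --> (0:R).
Proof.
move=> hr hg r0; apply/cvgrPdist_le => e e0.
have g0 := sqnorm_ge0 a b g.
pose w := (2 / e) * (sqnorm a b g + 1).
have w0 : 0 < w by rewrite mulr_gt0 ?divr_gt0// ltr_wpDl.
have d0 : 0 < w^-1 * (e / 2) by rewrite mulr_gt0 ?invr_gt0 ?divr_gt0.
move/cvgrPdist_le : r0 => /(_ _ d0); apply: filterS => t.
rewrite !sub0r !normrN !ger0_norm ?sqnorm_ge0 ?normc_ge0// => rt.
apply: (le_trans (L2inner_le (hr t) hg w0)).
have h1 : w * sqnorm a b (r t) <= e / 2.
  rewrite (le_trans (ler_wpM2l (ltW w0) rt))// mulrA mulfV ?mul1r//.
  exact: lt0r_neq0.
have h2 : w^-1 * sqnorm a b g <= e / 2.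
  rewrite mulrC ler_pdivrMr//.
  have -> : e / 2 * w = sqnorm a b g + 1 by rewrite /w; field; exact: lt0r_neq0.
  by rewrite lerDl.
by rewrite (splitr e) lerD.
Qed.

Section OrthogonalSeries.
Variable kappa : nat -> int.
Hypothesis kappaI : injective kappa.
Implicit Type c : nat -> R[i].

Definition trig c m n (x : R) := \sum_(m <= i < n) c i * expi (kappa i) x.

Lemma L2_trig a b c m n : L2 a b (trig c m n).
Proof. by apply: L2_sum => i; apply: L2Z; exact: L2_expi. Qed.

Lemma trig_split c m n p x : (m <= n)%N -> (n <= p)%N ->
  trig c m p x = trig c m n x + trig c n p x.
Proof. by move=> mn np; rewrite /trig (big_cat_nat mn np). Qed.

Lemma L2inner_trig c m n k : (m <= k < n)%N ->
  L2inner 0 tau (trig c m n) (expi (kappa k)) = real_complex R tau * c k.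
Proof.
move=> mkn; rewrite L2inner_suml; [|by move=> i; apply: L2Z;
  exact: L2_expi|exact: L2_expi].
rewrite (bigD1_seq k) ?mem_index_iota ?iota_uniq//= big1_seq ?addr0.
  by rewrite L2innerZl ?L2inner_expi ?eqxx ?mulr1 1?mulrC//; exact: L2_expi.
move=> i /andP[ik _]; rewrite L2innerZl; [|exact: L2_expi..].
by rewrite L2inner_expi (inj_eq kappaI) (negPf ik) !mulr0.
Qed.

Lemma L2inner_trigl c m n g : L2 0 tau g ->
  L2inner 0 tau (trig c m n) g
  = \sum_(m <= i < n) real_complex R tau * (c i * conjc (fourier g (kappa i))).
Proof.
move=> hg; rewrite L2inner_suml//; last by move=> i; apply: L2Z; exact: L2_expi.
apply: eq_bigr => i _; rewrite L2innerZl//; last exact: L2_expi.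
rewrite (L2innerC hg (L2_expi _ _ _)) L2innerE conjcM conjcR.
by rewrite mulrCA.
Qed.

Lemma fourier_trig c m n k : (m <= k < n)%N ->
  fourier (trig c m n) (kappa k) = c k.
Proof.
move=> mkn; rewrite fourierE L2inner_trig// mulrA -rmorphM mulVf; last first.
  exact: lt0r_neq0 tau_gt0.
exact: mul1r.
Qed.

Lemma sqnorm_trig c m n : sqnorm 0 tau (trig c m n)
  = tau * \sum_(m <= i < n) normc (c i) ^+ 2.
Proof.
have hT := L2_trig 0 tau c m n.
rewrite -[LHS]/(Re (real_complex R (sqnorm 0 tau (trig c m n)))) -L2inner_self//.
rewrite L2inner_trigl// mulr_sumr.
rewrite (eq_big_nat _ _ (F2 := fun i => real_complex R (tau * normc (c i) ^+ 2))).
  by rewrite -rmorph_sum.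
by move=> i mi; rewrite fourier_trig// mul_conjc -rmorphM.
Qed.

(** Bessel's identity, by orthogonality of the exponentials. *)
Lemma sqnorm_sub_trig h n : L2 0 tau h ->
  sqnorm 0 tau (fun x => h x - trig (fun i => fourier h (kappa i)) 0 n x)
  = sqnorm 0 tau h - tau * \sum_(0 <= i < n) normc (fourier h (kappa i)) ^+ 2.
Proof.
move=> hh; set c := fun i : nat => fourier h (kappa i); have hT := L2_trig 0 tau c 0 n.
rewrite sqnormD//; last exact: L2N.
rewrite sqnormN sqnorm_trig.
have -> : L2inner 0 tau h (fun x => - trig c 0 n x)
    = - real_complex R (tau * \sum_(0 <= i < n) normc (c i) ^+ 2).
  rewrite (L2innerC (L2N hT) hh).
  rewrite -(_ : (fun x => -1 * trig c 0 n x) = (fun x => - trig c 0 n x)); last first.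
    by apply/funext => x; rewrite mulN1r.
  rewrite L2innerZl// L2inner_trigl// mulN1r rmorphN; congr (- _).
  rewrite (eq_bigr (fun i => real_complex R (tau * normc (c i) ^+ 2))); last first.
    by move=> i _; rewrite mul_conjc -rmorphM.
  by rewrite -rmorph_sum mulr_sumr; exact: conjcR.
by rewrite cReN /=; ring.
Qed.

Lemma bessel h : L2 0 tau h ->
  bsum (fun i => normc (fourier h (kappa i)) ^+ 2).
Proof.
move=> hh; exists (tau^-1 * sqnorm 0 tau h) => n.
have := sqnorm_ge0 0 tau (fun x => h x - trig (fun i => fourier h (kappa i)) 0 n x).
rewrite sqnorm_sub_trig// subr_ge0 => H.
by rewrite ler_pdivlMl ?tau_gt0.
Qed.

Lemma integral_normc_trig_le c m n (e : R) : 0 < e ->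
  \sum_(m <= i < n) normc (c i) ^+ 2 <= e ^+ 2 ->
  (\int[mu]_(x in `]0%R, (2 * pi)%R[) (normc (trig c m n x))%:E <= (e * tau)%:E)%E.
Proof.
move=> e0 se; have hT := L2_trig 0 tau c m n.
have iT := L2_integrable hT.
have ic : mu.-integrable `]0, (tau : R)[ (EFin \o (fun=> 1)) := integrable_cst _ _ _.
have i1 := integrable_mulr (e^-1 / 2) iT.
have i2 := integrable_mulr (e / 2) ic.
apply: (@le_trans _ _ (\int[mu]_(x in `]0%R, (2 * pi)%R[)
    (e^-1 / 2 * normc (trig c m n x) ^+ 2 + e / 2 * 1)%:E)%E).
  apply: ge0_le_integral => //.
  - by move=> x _; rewrite lee_fin normc_ge0.
  - by apply/measurable_EFinP; apply: measurable_normc; exact: L2_cmeas.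
  - exact: (measurable_int mu (integrable_addr i1 i2)).
  - move=> x _; rewrite lee_fin; have e10 : 0 < e^-1 by rewrite invr_gt0.
    have H := normcM_le (trig c m n x) 1 e10.
    rewrite mulr1 invrK normc1 expr1n in H.
    by apply: (le_trans H); lra.
rewrite -[leLHS]fineK; last exact: integrable_fin_num (integrable_addr i1 i2).
rewrite lee_fin -/(Rintegral _ _ _) RintegralD// !RintegralZl//.
rewrite -/(sqnorm 0 tau _) sqnorm_trig Rintegral_cst//.
rewrite [X in fine X](_ : _ = tau%:E); last first.
  by rewrite /= lebesgue_measure_itv/= lte_fin tau_gt0 oppr0 adde0.
have -> : e * tau = e^-1 / 2 * (tau * e ^+ 2) + e / 2 * (1 * fine (tau : R)%:E).
  by rewrite /=; field; exact: lt0r_neq0.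
rewrite lerD2r; apply: ler_wpM2l; first by rewrite divr_ge0 ?invr_ge0 ?(ltW e0).
by apply: ler_wpM2l => //; exact: ltW tau_gt0.
Qed.

Lemma summable_trig_cvg (u : nat -> R) :
  (\sum_(j <oo) `|u j|%:E < +oo)%E -> cvgn (series u).
Proof.
move=> fin; apply: normed_cvg; apply: nondecreasing_is_cvgn.
  by apply: nondecreasing_series => n _ _; exact: normr_ge0.
exists (fine (\sum_(j <oo) `|u j|%:E)%E) => _ [n _ <-].
rewrite -lee_fin fineK; last by rewrite ge0_fin_numE// nneseries_ge0.
by rewrite /series/= -sumEFin; apply: nneseries_lim_ge => i _ _; rewrite lee_fin.
Qed.

(** A subsequence of the partial sums has increments whose L^1 norms are
    summable, hence converges almost everywhere; by Fatou's lemma the squared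
    L^2 distance from its limit to a partial sum is at most the tail of the
    series. *)
Lemma riesz_fischer c : bsum (fun i => normc (c i) ^+ 2) ->
  exists s, L2 0 tau s /\
    sqnorm 0 tau (fun x => s x - trig c 0 n x) @[n --> \oo] --> (0:R).
Proof.
move=> bc.
have c0 i : 0 <= normc (c i) ^+ 2 by exact: sqr_ge0.
have /choice[N hN] : forall j : nat, exists N, forall m n, (N <= m)%N ->
    \sum_(m <= i < n) normc (c i) ^+ 2 <= (2^-1 ^+ j) ^+ 2.
  by move=> j; apply: bsum_tail => //; rewrite !exprn_gt0.
(* The summand j makes M unbounded, so M (j + n) is beyond n in Fatou's lemma. *)
pose M j := (j + \sum_(0 <= i < j.+1) N i)%N.
have NM j : (N j <= M j)%N.
  by rewrite /M big_nat_recr//= addnA leq_addl.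
have jM j : (j <= M j)%N by exact: leq_addr.
have MS j : (M j <= M j.+1)%N.
  by rewrite /M [in leqRHS]big_nat_recr//= leq_add// leq_addr.
pose g j x := trig c (M j) (M j.+1) x.
pose G (x : R) := (\sum_(j <oo) (normc (g j x))%:E)%E.
have g0 j x : (0 <= (normc (g j x))%:E)%E by rewrite lee_fin normc_ge0.
have mg j : measurable_fun `]0, (tau : R)[ (fun x => (normc (g j x))%:E).
  by apply/measurable_EFinP; apply: measurable_normc; apply: L2_cmeas; exact: L2_trig.
have intG : (\int[mu]_(x in `]0%R, (2 * pi)%R[) G x <= (2 * tau)%:E)%E.
  rewrite integral_nneseries//.
  apply: lime_le; first by apply: is_cvg_nneseries => *; exact: integral_ge0.
  apply: nearW => n.
  apply: (@le_trans _ _ (\sum_(0 <= j < n) (2^-1 ^+ j * tau)%:E)%E).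
    apply: lee_sum => j _; apply: integral_normc_trig_le; rewrite ?exprn_gt0//.
    exact: hN.
  rewrite sumEFin lee_fin -mulr_suml; apply: ler_wpM2r; first exact: ltW tau_gt0.
  rewrite (_ : \sum_(0 <= j < n) _ = 2 - 2 * 2^-1 ^+ n); last first.
    elim: n => [|n ih]; first by rewrite big_geq// expr0 mulr1 subrr.
    by rewrite big_nat_recr//= ih exprS; field.
  by rewrite gerBl mulr_ge0// exprn_ge0.
have mG : measurable_fun `]0, (tau : R)[ G.
  apply: (@emeasurable_fun_cvg _ _ _ _ (fun n x => \sum_(0 <= j < n) (normc (g j
    x))%:E)%E).
    by move=> n; exact: emeasurable_sum.
  by move=> x _; exact: is_cvg_nneseries.
have iG : mu.-integrable `]0, (tau : R)[ G.
  apply/integrableP; split => //.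
  under eq_integral do rewrite gee0_abs ?nneseries_ge0//.
  by rewrite (le_lt_trans intG)// ltry.
pose T j x := trig c 0 (M j) x.
have mT j : cmeas `]0, (tau : R)[ (T j) by apply: L2_cmeas; exact: L2_trig.
(* An upper limit is measurable everywhere; it is the limit where there is one. *)
pose sre (x : R) := fine (limn_esup (fun j => (Re (T j x))%:E)).
pose sim (x : R) := fine (limn_esup (fun j => (Im (T j x))%:E)).
pose s x := Complex (sre x) (sim x).
have ms : cmeas `]0, (tau : R)[ s.
  split; apply: (measurableT_comp (f := fine)) => //;
    apply: measurable_fun_limn_esup => j; apply/measurable_EFinP; by have [] := mT j.
have Tcvg : {ae mu, forall x, x \in `]0, (tau : R)[ ->
    normc (T j x - s x) @[j --> \oo] --> (0:R)}.
  have aeG : {ae mu, forall x, x \in `]0, (tau : R)[ -> G x \is a fin_num}.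
    exact: integrable_ae iG.
  apply: ae_imply aeG => x /= Gx xI.
  have {}Gx : (G x < +oo)%E by move: (Gx xI); rewrite fin_numElt => /andP[].
  have TE j : T j x = T 0%N x + \sum_(0 <= i < j) g i x.
    elim: j => [|j ih]; first by rewrite big_geq// addr0.
    by rewrite big_nat_recr//= addrA -ih -trig_split.
  have part (p : R[i] -> R) : (forall z w, p (z + w) = p z + p w) ->
      (forall z, `|p z| <= normc z) -> p 0 = 0 ->
      p (T j x) @[j --> \oo] --> fine (limn_esup (fun j => (p (T j x))%:E)).
    move=> pD pn p0.
    have : cvgn (series (fun j => p (g j x))).
      apply: summable_trig_cvg; apply: le_lt_trans Gx.
      by apply: lee_nneseries => // *; rewrite lee_fin.
    move=> /cvg_ex[l hl].
    have cp : p (T j x) @[j --> \oo] --> p (T 0%N x) + l.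
      have -> : (fun j => p (T j x)) = (fun j => p (T 0%N x) + series (fun j => p (g
        j x)) j).
        apply/funext => j; rewrite TE pD; congr (_ + _).
        rewrite /series/=; elim: j => [|j ih]; first by rewrite !big_geq.
        by rewrite !big_nat_recr//= pD ih.
      by apply: cvgD => //; exact: cvg_cst.
    rewrite (_ : fine _ = p (T 0%N x) + l)//.
    have : (p (T j x))%:E @[j --> \oo] --> (p (T 0%N x) + l)%:E.
      by apply/fine_cvgP; split; [exact: nearW|exact: cp].
    by move=> /cvg_limn_einf_sup[_ ->].
  have cre := part _ cReD (@Re_le_normc R) erefl.
  have cim := part _ cImD (@Im_le_normc R) erefl.
  apply: (@squeeze_cvg0 _ _ _ _ _ (fun j => `|Re (T j x) - sre x| + `|Im (T j x) -
    sim x|)).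
    by move=> j; rewrite normc_ge0 (le_trans (normc_le_ReIm _))// !ReImE.
  have := cvgD ((cvg_distP _ _).1 cre) ((cvg_distP _ _).1 cim).
  by rewrite addr0; apply.
have fatou_s n e : 0 <= e ->
    (forall m, (n <= m)%N -> \sum_(n <= i < m) normc (c i) ^+ 2 <= e) ->
    (L2sqnorm 0 tau (fun x => (s x - trig c 0 n x)%R) <= (tau * e)%:E)%E.
  move=> e0 he.
  have mS : cmeas `]0, (tau : R)[ (trig c 0 n) by apply: L2_cmeas; exact: L2_trig.
  pose f j x := ((normc (T (j + n)%N x - trig c 0 n x) ^+ 2)%:E : \bar R).
  have mf j : measurable_fun `]0, (tau : R)[ (f j).
    by apply/measurable_EFinP; apply: measurable_normc2; exact: cmeasB.
  have f0 j x : (0 <= f j x)%E by rewrite lee_fin sqr_ge0.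
  have -> : L2sqnorm 0 tau (fun x => s x - trig c 0 n x)
      = (\int[mu]_(x in `]0%R, (2 * pi)%R[) limn_einf (f^~ x))%E.
    apply: ae_eq_integral => //.
    - by apply/measurable_EFinP; apply: measurable_normc2; exact: cmeasB.
    - rewrite (_ : (fun x => _) = (fun x => - limn_esup (fun j => - f j x))%E).
        apply: (measurableT_comp (f := -%E)) => //.
        apply: measurable_fun_limn_esup => j.
        by apply: (measurableT_comp (f := -%E)) => //; exact: mf.
      by apply/funext => x; rewrite -[LHS]oppeK -limn_esupN.
    - apply: ae_imply Tcvg => x /= cT xI; apply/esym.
      suff : f j x @[j --> \oo] --> (normc (s x - trig c 0 n x) ^+ 2)%:E.
        by move=> /cvg_limn_einf_sup[->].
      apply/fine_cvgP; split; first exact: nearW.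
      have cn : normc (T (j + n)%N x - trig c 0 n x) @[j --> \oo]
          --> normc (s x - trig c 0 n x).
        apply/cvg_distP; apply: (@squeeze_cvg0 _ _ _ _ _
          (fun j => normc (T (j + n)%N x - s x))).
          move=> j; rewrite normr_ge0/=.
          rewrite -[X in `|normc (X - _) - _|](subrK (s x)) ler_norml.
          have h1 := normcD (T (j + n)%N x - s x) (s x - trig c 0 n x).
          have h2 := normcD (s x - T (j + n)%N x) (T (j + n)%N x - trig c 0 n x).
          move: h1 h2; rewrite !addrA !subrK (normcB (s x) (T _ _)) => h1 h2.
          by apply/andP; split; lra.
        have := cT xI; rewrite -(cvg_shiftn n) /=.
        exact.
      exact: (cvgM cn cn).
  apply: (le_trans (fatou mu (measurable_itv _) mf (fun j x _ => f0 j x))).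
  rewrite limn_einf_lim; apply: lime_le; first exact: is_cvg_einfs.
  apply: nearW => j; apply: (@le_trans _ _ (\int[mu]_(x in `]0%R, (2 * pi)%R[) f j x)%E).
    by apply: ereal_inf_lbound; exists j => /=.
  have nM : (n <= M (j + n))%N by rewrite (leq_trans _ (jM _))// leq_addl.
  have -> : (\int[mu]_(x in `]0%R, (2 * pi)%R[) f j x)%E
      = L2sqnorm 0 tau (trig c n (M (j + n)%N)).
    apply: eq_integral => x _; rewrite /f /T (@trig_split c 0 n)//.
    by rewrite addrAC subrr add0r.
  rewrite L2sqnormE; last exact: L2_trig.
  rewrite lee_fin sqnorm_trig; apply: ler_wpM2l; first exact: ltW tau_gt0.
  exact: he.
have hs : L2 0 tau s.
  have [N1 hN1] := bsum_tail c0 bc ltr01.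
  have l2 : L2 0 tau (fun x => s x - trig c 0 N1 x).
    have [d1 d2] : cmeas `]0, (tau : R)[ (fun x => s x - trig c 0 N1 x).
      by apply: cmeasB => //; apply: L2_cmeas; exact: L2_trig.
    split => //; apply: (le_lt_trans (fatou_s N1 1 ler01 _)); last exact: ltry.
    by move=> m _; exact: hN1.
  have := L2D l2 (L2_trig 0 tau c 0 N1).
  by under eq_fun do rewrite subrK.
exists s; split => //; apply/cvgrPdist_le => e e0.
have e0' : 0 < tau^-1 * e by rewrite mulr_gt0// invr_gt0 tau_gt0.
have [N1 hN1] := bsum_tail c0 bc e0'.
exists N1 => // n /= N1n; rewrite sub0r normrN ger0_norm ?sqnorm_ge0//.
have := fatou_s n _ (ltW e0') (fun m _ => hN1 n m N1n).
rewrite L2sqnormE ?lee_fin; last by apply: L2B => //; exact: L2_trig.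
by rewrite mulrA mulfV ?mul1r// lt0r_neq0 ?tau_gt0.
Qed.

(** The frequencies form an arbitrary injective sequence: an enumeration of Z
    gives Fourier series, and the frequencies of the evolution give the
    control. *)
Lemma riesz_fischer_fourier c : bsum (fun i => normc (c i) ^+ 2) ->
  exists s, [/\ L2 0 tau s, forall i, fourier s (kappa i) = c i &
    sqnorm 0 tau (fun x => s x - trig c 0 n x) @[n --> \oo] --> (0:R)].
Proof.
move=> bc; have [s [hs cs]] := riesz_fischer bc; exists s; split => // i.
have hd n : L2 0 tau (fun x => s x - trig c 0 n x) by apply: L2B => //; exact: L2_trig.
have ci : normc (L2inner 0 tau (fun x => s x - trig c 0 n x) (expi (kappa i)))
    @[n --> \oo] --> (0:R).
  by apply: L2inner_cvg0 => //; exact: L2_expi.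
apply/eqP; rewrite -subr_eq0; apply/eqP/eq0_normc.
have tau0 : normc (real_complex R tau) != 0.
  by rewrite normcR normr_eq0 lt0r_neq0 ?tau_gt0.
apply: (mulfI tau0); rewrite mulr0 -normcM mulrBr -L2innerE.
have /(cvg_lim (@Rhausdorff R)) <- : normc (L2inner 0 tau (fun x => s x - trig c 0 n
  x) (expi (kappa i)))
    @[n --> \oo] --> normc (L2inner 0 tau s (expi (kappa i)) - real_complex R tau * c i).
  apply: cvg_near_cst; exists i.+1 => // n ni; have {}ni : (i < n)%N := ni.
  by rewrite L2innerBl ?L2inner_trig//; [exact: L2_trig|exact: L2_expi].
exact: (cvg_lim (@Rhausdorff R) ci).
Qed.

End OrthogonalSeries.

(** * Parseval identities *)

(** The enumeration 0, -1, 1, -2, 2, ... of the integers. *)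
Definition zenum (n : nat) : int := if odd n then Negz n./2 else Posz n./2.

Lemma zenum_bij : bijective zenum.
Proof.
exists (fun k => match k with Posz n => n.*2 | Negz n => n.*2.+1 end).
  by move=> n; rewrite /zenum; case: ifP => on; rewrite -[RHS]odd_double_half on.
by case=> n; rewrite /zenum /= ?odd_double ?half_double ?uphalf_double.
Qed.

Lemma zenum_inj : injective zenum. Proof. exact: bij_inj zenum_bij. Qed.

Lemma zenum_surj k : exists n, zenum n = k.
Proof. by case: zenum_bij => z' _ zK; exists (z' k). Qed.

Definition hat h n := fourier h (zenum n).

(** The series of h has some sum by Riesz-Fischer, which has the same Fourier
    coefficients as h and thus equals h. *)
Lemma parseval_cvg h : L2 0 tau h ->
  sqnorm 0 tau (fun x => h x - trig zenum (hat h) 0 n x) @[n --> \oo] --> (0:R).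
Proof.
move=> hh.
have [s [hs sE cs]] := riesz_fischer_fourier zenum_inj (bessel zenum_inj hh).
have sh : L2eq 0 tau h s.
  apply: fourier_unique => // k; have [n <-] := zenum_surj k.
  by rewrite sE.
rewrite (_ : (fun n => _) = (fun n => sqnorm 0 tau (fun x => s x - trig zenum (hat h)
  0 n x)))//.
apply/funext => n; apply: L2eq_sqnorm.
- by apply: L2B => //; exact: L2_trig.
- by apply: L2B => //; exact: L2_trig.
- exact: L2eqB sh (L2eq_refl _ _ _).
Qed.

Lemma parseval_sqnorm h : L2 0 tau h ->
  \sum_(0 <= i < n) tau * normc (hat h i) ^+ 2 @[n --> \oo] --> sqnorm 0 tau h.
Proof.
move=> hh; apply/cvg_distP.
rewrite (_ : (fun n => _) = (fun n => sqnorm 0 tau (fun x => h x - trig zenum (hat h)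
  0 n x))).
  exact: parseval_cvg.
apply/funext => n; rewrite sqnorm_sub_trig//; last exact: zenum_inj.
rewrite -mulr_sumr distrC ger0_norm// -sqnorm_sub_trig ?sqnorm_ge0//; exact: zenum_inj.
Qed.

Lemma parseval_inner h g : L2 0 tau h -> L2 0 tau g ->
  normc (\sum_(0 <= i < n) real_complex R tau * (hat h i * conjc (hat g i))
    - L2inner 0 tau h g) @[n --> \oo] --> (0:R).
Proof.
move=> hh hg.
have hd n : L2 0 tau (fun x => h x - trig zenum (hat h) 0 n x).
  by apply: L2B => //; exact: L2_trig.
have : normc (L2inner 0 tau (fun x => h x - trig zenum (hat h) 0 n x) g)
    @[n --> \oo] --> (0:R).
  by apply: L2inner_cvg0 => //; exact: parseval_cvg.
rewrite (_ : (fun n => _) = (fun n => normc (\sum_(0 <= i < n)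
  real_complex R tau * (hat h i * conjc (hat g i)) - L2inner 0 tau h g)))//.
apply/funext => n; rewrite L2innerBl//; last exact: L2_trig.
by rewrite L2inner_trigl// normcB.
Qed.

End RieszFischer.

(** * Test functions *)

Section TestFunctions.
Context {R : realType}.
Local Notation Re := complex.Re.
Local Notation Im := complex.Im.
Local Notation mu := (@lebesgue_measure R).
Local Notation tau := (2 * pi).
Implicit Types f g phi : R -> R.

Lemma is_derive_mul f g (x a b : R) : is_derive x 1 f a -> is_derive x 1 g b ->
  is_derive x 1 (fun y => f y * g y) (f x * b + g x * a).
Proof. by move=> df dg; exact: (is_deriveM df dg). Qed.

Lemma is_derive_add f g (x a b : R) : is_derive x 1 f a -> is_derive x 1 g b ->
  is_derive x 1 (fun y => f y + g y) (a + b).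
Proof. by move=> df dg; exact: (is_deriveD df dg). Qed.

Lemma is_derive_scale f (c x a : R) : is_derive x 1 f a ->
  is_derive x 1 (fun y => c * f y) (c * a).
Proof. by move=> df; exact: (is_deriveZ c df). Qed.

(** The functions x^-k exp(-1/x), which vanish to infinite order at 0. *)
Definition flat (k : nat) (x : R) :=
  if 0 < x then x^-1 ^+ k * expR (- x^-1) else 0.

Lemma flat_ge0 k x : 0 <= flat k x.
Proof.
rewrite /flat; case: ifPn => // x0.
by rewrite mulr_ge0 ?expR_ge0// exprn_ge0// invr_ge0 ltW.
Qed.

(** From exp(y) >= y^(k+1) / (k+1)! at y = 1/x. For k + 1 in place of k it
    gives the derivative of flat k at 0. *)
Lemma flat_le k x : flat k x <= k.+1`!%:R * `|x|.
Proof.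
rewrite /flat; case: ifPn => [x0|_]; last by rewrite mulr_ge0.
have y0 : 0 <= x^-1 by rewrite invr_ge0 ltW.
have fk0 : 0 < k.+1`!%:R :> R by rewrite ltr0n fact_gt0.
rewrite ger0_norm ?(ltW x0)// expRN ler_pdivrMr ?expR_gt0//.
have : x^-1 ^+ k.+1 / k.+1`!%:R <= expR (x^-1).
  by apply: le_trans (expR_ge1Dxn k y0); rewrite lerDr.
rewrite ler_pdivrMr// => H.
have := ler_wpM2l (ltW x0) H.
rewrite exprS mulrA mulfV ?lt0r_neq0// mul1r => {}H.
by rewrite (le_trans H)// le_eqVlt; apply/orP; left; apply/eqP; ring.
Qed.

Lemma is_derive_flat k (x : R) :
  is_derive x 1 (flat k) (flat k.+2 x - k%:R * flat k.+1 x).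
Proof.
have [x0|x0|->] := ltgtP x 0.
- have -> : flat k.+2 x - k%:R * flat k.+1 x = 0.
    by rewrite /flat !ltNge (ltW x0)/= mulr0 subr0.
  apply: (@near_eq_is_derive _ _ _ (cst 0)).
  near=> y; rewrite /flat ifF//; apply/negbTE; rewrite -leNgt ltW//.
  by near: y; exact: lt_nbhsl.
- have dV : is_derive x 1 (fun y : R => y^-1) (- x ^- 2).
    have := @is_deriveV R id x 1 1 (lt0r_neq0 x0) (is_derive_id _ _).
    by rewrite [_ *: _]mulr1.
  have dX : is_derive x 1 (fun y : R => y^-1 ^+ k) (k%:R * x^-1 ^+ k.-1 * (- x ^- 2)).
    have := @is_deriveX _ _ (fun y : R => y^-1) k x 1 _ dV.
    rewrite (_ : (fun y : R => y^-1) ^+ k = (fun y => y^-1 ^+ k))//.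
    by apply/funext => y; elim: k => //= k ih; rewrite !exprS -ih.
  have dE : is_derive x 1 (fun y : R => expR (- y^-1)) (expR (- x^-1) * x ^- 2).
    have dN := is_derive_scale (-1) dV.
    have := @is_derive1_comp _ expR (fun y => -1 * y^-1) x _ _ (is_derive_expR _) dN.
    by rewrite !mulN1r opprK (_ : _ \o _ = (fun y => expR (- y^-1)))//;
      apply/funext => y; rewrite /= mulN1r.
  have := is_derive_mul dX dE.
  rewrite (_ : _ + _ = flat k.+2 x - k%:R * flat k.+1 x); last first.
    rewrite /flat x0 -exprVn; case: k {dX} => [|k]/=.
      by rewrite !mul0r !mulr0 addr0 subr0 mul1r mulrC.
    by rewrite !exprS; ring.
  apply: near_eq_is_derive; near=> y; rewrite /flat ifT//.
  by near: y; exact: lt_nbhsr.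
- have -> : flat k.+2 0 - k%:R * flat k.+1 0 = 0 by rewrite /flat ltxx/= mulr0 subr0.
  have H : h^-1 *: ((flat k \o shift 0) (h *: 1) - flat k 0) @[h --> (0:R)^'] --> (0:R).
    apply/cvg_distP; apply: (@squeeze_cvg0 _ _ _ _ _ (fun h : R => k.+2`!%:R * `|h|)).
      move=> h; rewrite normr_ge0/= subr0 addr0 [_ *: 1]mulr1.
      rewrite [flat k 0]/flat ltxx subr0 (_ : h^-1 *: flat k h = h^-1 * flat k h)//.
      have [h0|h0] := leP h 0.
        by rewrite /flat ltNge h0/= mulr0 normr0 mulr_ge0.
      rewrite (_ : h^-1 * flat k h = flat k.+1 h); last first.
        by rewrite /flat h0 exprS mulrA.
      by rewrite ger0_norm ?flat_ge0 ?flat_le.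
    rewrite -[X in _ --> X](mulr0 (k.+2`!%:R : R)).
    apply: cvgM; first exact: cvg_cst.
    rewrite -[X in _ --> X](@normr0 _ R).
    apply: cvg_norm; apply: cvg_within_filter.
    exact: cvg_id.
  by apply: DeriveDef; [exact: cvgP H|exact: (cvg_lim (@Rhausdorff R) H)].
Unshelve. all: by end_near. Qed.

(** A class of functions closed under differentiation that contains
    bump_test below; its members are therefore smooth. *)
Inductive flat_span (n c d : R) : (R -> R) -> Prop :=
| FlatProd k l : flat_span n c d (fun x => flat k (n * (x - c)) * flat l (n * (d - x)))
| FlatAdd f g : flat_span n c d f -> flat_span n c d g ->
    flat_span n c d (fun x => f x + g x)
| FlatScale a f : flat_span n c d f -> flat_span n c d (fun x => a * f x).

Lemma is_derive_flat_affine k (al be x : R) :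
  is_derive x 1 (fun y => flat k (al * y + be))
   (al * (flat k.+2 (al * x + be) - k%:R * flat k.+1 (al * x + be))).
Proof.
have dA : is_derive x 1 (fun y => al * y + be) al.
  have := is_derive_add (is_derive_mull al x) (is_derive_cst be x 1).
  by rewrite addr0.
have := @is_derive1_comp _ (flat k) (fun y => al * y + be) x _ _
  (is_derive_flat k (al * x + be)) dA.
by rewrite mulrC.
Qed.

Lemma flat_span_derive n c d f : flat_span n c d f ->
  exists2 g, flat_span n c d g & forall x : R, is_derive x 1 f (g x).
Proof.
elim=> {f} [k l|f g _ [f' sf df] _ [g' sg dg]|a f _ [f' sf df]].
- pose G i j := fun x : R => flat i (n * (x - c)) * flat j (n * (d - x)).
  exists (fun x => n * ((G k.+2 l x + - k%:R * G k.+1 l x) +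
      ((- 1) * G k l.+2 x + l%:R * G k l.+1 x))).
    by do ![exact: FlatProd|apply: FlatAdd|apply: FlatScale].
  move=> x; have := is_derive_mul (is_derive_flat_affine k n (- (n * c)) x)
    (is_derive_flat_affine l (- n) (n * d) x).
  have E1 y : n * y + - (n * c) = n * (y - c) by ring.
  have E2 y : - n * y + n * d = n * (d - y) by ring.
  under eq_fun do rewrite E1 E2.
  rewrite E1 E2; congr is_derive; rewrite /G; ring.
- exists (fun x => f' x + g' x); first exact: FlatAdd.
  by move=> x; exact: is_derive_add.
- exists (fun x => a * f' x); first exact: FlatScale.
  by move=> x; exact: is_derive_scale.
Qed.

Lemma flat_span_smooth n c d f : flat_span n c d f ->
  forall j (x : R), derivable (derive1n j f) x 1.
Proof.
move=> sf j; suff [g sg dg] : exists2 g, flat_span n c d g & derive1n j f = g.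
  rewrite dg => x; have [g' _ dg'] := flat_span_derive sg.
  by have [] := dg' x.
elim: j => [|j [g sg E]]; first by exists f.
have [g' sg' dg'] := flat_span_derive sg.
exists g' => //; rewrite derive1nS E; apply/funext => x.
by rewrite derive1E; have [_ ->] := dg' x.
Qed.

(** They tend to the indicator of (c, d), because exp(-1/(n y)) tends to 1. *)
Definition bump_test (n : nat) (c d x : R) :=
  flat 0 (n.+1%:R * (x - c)) * flat 0 (n.+1%:R * (d - x)).

Lemma bump_test_function n c d : 0 < c -> d < tau ->
  test_function (bump_test n c d).
Proof.
move=> c0 dt; split.
  move=> j x; apply: (@flat_span_smooth n.+1%:R c d); exact: FlatProd.
exists c, d; split => // x; rewrite in_itv/= negb_and -!ltNge /bump_test /flat.
have n0 : 0 < n.+1%:R :> R by rewrite ltr0n.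
by rewrite !pmulr_rgt0// !subr_gt0; case/orP => h;
  rewrite ?(ltNge c) ?(ltNge x d) ?(ltW h)/= ?mul0r ?mulr0.
Qed.

Lemma flat0_le1 x : flat 0 x <= 1.
Proof.
rewrite /flat; case: ifPn => // x0.
by rewrite mul1r expR_le1 oppr_le0 invr_ge0 ltW.
Qed.

Lemma bump_test01 n c d x : 0 <= bump_test n c d x <= 1.
Proof. by rewrite /bump_test mulr_ge0 ?flat_ge0// mulr_ile1 ?flat_ge0 ?flat0_le1. Qed.

Lemma flat0_cvg (y : R) : 0 < y -> flat 0 (n.+1%:R * y) @[n --> \oo] --> (1:R).
Proof.
move=> y0; apply/cvg_distP.
apply: (@squeeze_cvg0 _ _ _ _ _ (fun n => y^-1 * n.+1%:R^-1)).
  move=> n; rewrite normr_ge0/= ler0_norm ?subr_le0 ?flat0_le1// opprB.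
  rewrite /flat pmulr_rgt0// y0 expr0 mul1r lerBlDr -lerBlDl.
  by rewrite -invfM mulrC; exact: expR_ge1Dx.
rewrite -[X in _ --> X](mulr0 y^-1); apply: cvgM; first exact: cvg_cst.
exact: cvg_harmonic.
Qed.

(** The fundamental lemma of the calculus of variations: testing against
    bump_test shows that h has integral 0 over every interval. *)
Lemma test_function_separates (h : R -> R[i]) : cintegrable 0 tau h ->
  (forall phi, test_function phi ->
     cint 0 tau (fun x => real_complex R (phi x) * h x) = 0) ->
  L2eq 0 tau h (fun=> 0).
Proof.
move=> ih h0; apply: L2eq0_of_cint_itv => // c d c0 cd dt.
rewrite (@cint_restrict _ 0 tau) ?ltW//.
have contb n : continuous (bump_test n c d).
  move=> x; apply: differentiable_continuous; apply/derivable1_diffP.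
  by have [/(_ 0%N x)] := bump_test_function n c0 dt.
have mb n : cmeas `]0, (tau : R)[ (fun x => real_complex R (bump_test n c d x) * h x).
  apply: cmeasM; last exact: cintegrable_cmeas.
  apply: cmeas_real; apply: (measurable_funS measurableT) => //.
  exact: continuous_measurable_fun.
have [|x xI|_] := @cint_dominated _ 0 tau _ (fun x => if x \in `]c, d[ then h x else 0)
    _ mb (cintegrable_normc ih).
- move=> n x _; rewrite normcM normcR; have /andP[b0 b1] := bump_test01 n c d x.
  by rewrite ger0_norm// ler_piMl// normc_ge0.
- case: ifPn; rewrite in_itv/=.
    move=> /andP[cx xd].
    under eq_fun do rewrite -{2}[h x]mul1r -mulrBl normcM -[1]/(real_complex R 1)
      -rmorphB normcR.
    have c1 : `|bump_test n c d x - 1| @[n --> \oo] --> (0:R).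
      apply: (iffLR (cvg_distP _ _)); rewrite -[X in _ --> X](mulr1 (1:R)).
      by apply: cvgM; apply: flat0_cvg; rewrite subr_gt0.
    by have := cvgM c1 (cvg_cst (normc (h x))); rewrite mul0r; apply.
  move=> xcd; have b0 n : bump_test n c d x = 0.
    rewrite /bump_test /flat !pmulr_rgt0// !subr_gt0.
    by move: xcd; rewrite negb_and => /orP[/negPf ->|/negPf ->]; rewrite ?mul0r ?mulr0.
  under eq_fun do rewrite b0 mul0r subr0 normc0.
  exact: cvg_cst.
- under eq_fun do rewrite (h0 _ (bump_test_function _ c0 dt)) sub0r normcN.
  move=> /(cvg_lim (@Rhausdorff R)); rewrite lim_cst//.
  exact: eq0_normc.
Qed.

End TestFunctions.

(** * The operator as a Fourier multiplier *)

#[local] Arguments L2inner : simpl never.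
#[local] Arguments cint : simpl never.
#[local] Arguments fourier : simpl never.

Section Generator.
Context {R : realType}.
Local Notation Re := complex.Re.
Local Notation Im := complex.Im.
Local Notation mu := (@lebesgue_measure R).
Local Notation tau := (2 * pi).
Implicit Types (phi : R -> R) (h g d : R -> R[i]).

Lemma complex_cvg_unique (u : nat -> R[i]) (a b : R[i]) :
  normc (u n - a) @[n --> \oo] --> (0:R) ->
  normc (u n - b) @[n --> \oo] --> (0:R) -> a = b.
Proof.
move=> ua ub; apply/eqP; rewrite -subr_eq0; apply/eqP/eq0_normc.
have uab : normc (a - b) @[n --> \oo] --> (0:R).
  apply: (@squeeze_cvg0 _ _ _ _ _ (fun n => normc (u n - a) + normc (u n - b))).
    move=> n; rewrite normc_ge0 (normcB (u n) a).
    by rewrite (le_trans _ (normcD _ _))// addrA subrK.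
  by have := cvgD ua ub; rewrite addr0; apply.
by rewrite -(cvg_lim (@Rhausdorff R) uab) lim_cst.
Qed.

Lemma test_continuous phi : test_function phi -> continuous phi.
Proof.
move=> [sm _] x; apply: differentiable_continuous; apply/derivable1_diffP.
exact: (sm 0%N x).
Qed.

Lemma test_function_derive phi : test_function phi -> test_function (derive1 phi).
Proof.
move=> [sm [c [d [c0 dt supp]]]]; split.
  by move=> n x; rewrite -derive1Sn; exact: sm.
exists c, d; split => // x xcd.
rewrite derive1E (@near_eq_derive _ _ _ phi (cst 0)) ?derive_cst//.
move: xcd; rewrite in_itv/= negb_and -!ltNge => /orP[xc|dx].
  near=> y; rewrite supp// in_itv/= negb_and -!ltNge; apply/orP; left.
  by near: y; exact: lt_nbhsl.
near=> y; rewrite supp// in_itv/= negb_and -!ltNge; apply/orP; right.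
by near: y; exact: lt_nbhsr.
Unshelve. all: by end_near. Qed.

Lemma test_function_derive1n j phi : test_function phi ->
  test_function (derive1n j phi).
Proof. by move=> tp; elim: j => // j ih; rewrite derive1nS;
  exact: test_function_derive. Qed.

Lemma test_L2 phi : test_function phi ->
  L2 0 tau (fun x => real_complex R (phi x)).
Proof.
move=> tp; have cp := test_continuous tp.
apply: (@L2_le _ _ _ _ (fun x => phi x * phi x)).
- apply: cmeas_real; apply: (measurable_funS measurableT) => //.
  exact: continuous_measurable_fun.
- have : mu.-integrable `[0, (tau : R)] (EFin \o (fun x => phi x * phi x)).
    apply: continuous_compact_integrable; first exact: segment_compact.
    apply: continuous_subspaceT => x; apply: cvgM; exact: cp.
  apply: integrableS => //.
  by apply: subset_itv; rewrite bnd_simp.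
- by move=> x _; rewrite normcR real_normK ?num_real// expr2.
Qed.

Definition ik (k : int) : R[i] := Complex 0 k%:~R.

Lemma normc_ik k : normc (ik k) = `|k%:~R|.
Proof. by rewrite /= expr0n add0r sqrtr_sqr. Qed.

Lemma conj_ik k : conjc (ik k) = - ik k.
Proof. by apply: complexP; rewrite !ReImE /= ?oppr0. Qed.

(** Integration by parts, without boundary terms. *)
Lemma fourier_test_derive phi k : test_function phi ->
  fourier (fun x => real_complex R (derive1 phi x)) k
  = ik k * fourier (fun x => real_complex R (phi x)) k.
Proof.
move=> tp; have tp' := test_function_derive tp.
have [c [d [c0 dt supp]]] := tp.2.
have phi0 : phi 0 = 0 by rewrite supp// in_itv/= leNgt c0.
have phit : phi tau = 0 by rewrite supp// in_itv/= andbC leNgt dt.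
have cp := test_continuous tp; have cp' := test_continuous tp'.
have dphi (x : R) : is_derive x 1 phi (derive1 phi x).
  by apply: DeriveDef; [exact: (tp.1 0%N x)|rewrite derive1E].
have l1 := test_L2 tp; have l2 := test_L2 tp'.
have lk := L2_expi 0 (2 * pi : R) k.
suff : L2inner 0 tau (fun x => real_complex R (derive1 phi x)
    + (- ik k) * real_complex R (phi x)) (expi k) = 0.
  move=> h0; apply/eqP; rewrite -subr_eq0 -mulNr -fourierZ// -fourierD//.
    by rewrite fourierE h0 mulr0.
  exact: L2Z.
have dcos (x : R) := is_derive_mul (dphi x) (is_derive_cosM k%:~R x).
have dsin (x : R) := is_derive_scale (-1) (is_derive_mul (dphi x) (is_derive_sinM
  k%:~R x)).
have ccos := @continuous_cosM R k%:~R; have csin := @continuous_sinM R k%:~R.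
apply: complexP.
  rewrite /L2inner /cint.
  transitivity (phi tau * cos (k%:~R * tau) - phi 0 * cos (k%:~R * 0)); last first.
    by rewrite phi0 phit !mul0r subrr.
  rewrite -(Rintegral_FTC tau_gt0 dcos).
    by apply: eq_Rintegral => x _; rewrite !ReImE /=; ring.
  move=> x; apply: cvgD; apply: cvgM; [exact: cp| |exact: ccos|exact: cp'].
  by apply: cvgN; apply: cvgM; [exact: cvg_cst|exact: csin].
rewrite /L2inner /cint.
transitivity (-1 * (phi tau * sin (k%:~R * tau)) - -1 * (phi 0 * sin (k%:~R * 0)));
  last first.
  by rewrite phi0 phit !mul0r subrr.
rewrite -(Rintegral_FTC tau_gt0 dsin).
  by apply: eq_Rintegral => x _; rewrite !ReImE /=; ring.
move=> x; apply: cvgM; first exact: cvg_cst.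
apply: cvgD; apply: cvgM; [exact: cp| |exact: csin|exact: cp'].
by apply: cvgM; [exact: cvg_cst|exact: ccos].
Qed.

Lemma fourier_test_derive1n j phi k : test_function phi ->
  fourier (fun x => real_complex R (derive1n j phi x)) k
  = ik k ^+ j * fourier (fun x => real_complex R (phi x)) k.
Proof.
move=> tp; elim: j => [|j ih]; first by rewrite expr0 mul1r.
by rewrite derive1nS fourier_test_derive ?ih ?exprS ?mulrA//;
  exact: test_function_derive1n.
Qed.

Lemma cint_testE phi h : test_function phi ->
  cint 0 tau (fun x => real_complex R (phi x) * h x)
  = L2inner 0 tau h (fun x => real_complex R (phi x)).
Proof. by move=> tp; apply: eq_cint => x _; rewrite conjcR mulrC. Qed.

(** By Parseval both sides of the duality formula are series, which agree
    term by term because the conjugate of ik is its opposite. *)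
Lemma weak_derivative_of_fourier j h d : L2 0 tau h -> L2 0 tau d ->
  (forall k, fourier d k = ik k ^+ j * fourier h k) -> weak_derivative j h d.
Proof.
move=> hh hd dE; split => // phi tp; have tpj := test_function_derive1n j tp.
rewrite !cint_testE//.
have p1 := parseval_inner hh (test_L2 tpj).
have p2 := parseval_inner hd (test_L2 tp).
apply: (complex_cvg_unique p1).
rewrite (_ : (fun n => _) = (fun n => normc (\sum_(0 <= i < n)
    real_complex R tau * (hat d i * conjc (hat (fun x => real_complex R (phi x)) i)) -
    L2inner 0 tau d (fun x => real_complex R (phi x)))))//.
have n1 : normc ((-1 : R[i]) ^+ j) = 1 by rewrite normcX normcN normc1 expr1n.
apply/funext => n; rewrite -[RHS]mul1r -[X in _ = X * _]n1.
rewrite -normcM mulrBr mulr_sumr; congr (normc (_ - _)).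
apply: eq_bigr => i _; rewrite /hat fourier_test_derive1n// dE conjcM.
have -> : conjc (ik (zenum i) ^+ j) = (-1) ^+ j * ik (zenum i) ^+ j.
  rewrite -exprMn mulN1r -conj_ik; exact: rmorphXn.
by ring.
Qed.

Lemma weak_derivative_unique j h d d' :
  weak_derivative j h d -> weak_derivative j h d' -> L2eq 0 tau d d'.
Proof.
move=> [hd wd] [hd' wd'].
have h0 : L2eq 0 tau (fun x => d x - d' x) (fun=> 0).
  apply: test_function_separates; first by apply: L2_cintegrable; exact: L2B.
  move=> phi tp; rewrite cint_testE// L2innerBl//; last exact: test_L2.
  have u : (-1 : R[i]) ^+ j != 0 by rewrite expf_neq0// oppr_eq0 oner_eq0.
  apply: (mulfI u); rewrite mulr0 mulrBr -!cint_testE//.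
  by rewrite -wd// -wd'// subrr.
by apply: ae_imply h0 => x /= e0 /e0/eqP; rewrite subr_eq0 => /eqP.
Qed.

Lemma weak_derivative_exists j h : H5p h -> (j <= 5)%N ->
  exists d, [/\ L2 0 tau d, forall k, fourier d k = ik k ^+ j * fourier h k &
    weak_derivative j h d].
Proof.
move=> [hh h5] j5.
have b5 := (bsum_esum zenum_bij (fun k => mulr_ge0 (sqr_ge0 _) (exprn_ge0 5 (addr_ge0
  ler01 (sqr_ge0 _))))).1 h5.
have bc : bsum (fun n => normc (ik (zenum n) ^+ j * hat h n) ^+ 2).
  apply: bsum_le b5 => n /=; rewrite normcM exprMn mulrC ler_wpM2l ?sqr_ge0//.
  rewrite normcX normc_ik -exprM mulnC exprM real_normK ?num_real//.
  set y := _ ^+ 2; have y0 : 0 <= y by exact: sqr_ge0.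
  apply: (@le_trans _ _ ((1 + y) ^+ j)).
    by apply: lerXn2r; rewrite ?nnegrE ?addr_ge0 ?lerDr.
  by rewrite ler_weXn2l// lerDl.
have [d [hd dE _]] := riesz_fischer_fourier zenum_inj bc.
have {}dE k : fourier d k = ik k ^+ j * fourier h k.
  by have [n <-] := zenum_surj k; rewrite dE.
by exists d; split => //; exact: weak_derivative_of_fourier.
Qed.

(** The operator maps exp(ikx) to i freq(k) exp(ikx). *)
Definition freq (k : int) : int := k ^+ 5 + k ^+ 3 - k.

Lemma ik_freq k : ik k ^+ 5 - ik k ^+ 3 - ik k = ik (freq k).
Proof.
have -> : ik k = Complex 0 1 * real_complex R k%:~R.
  by apply: complexP; rewrite !ReImE /=; ring.
have -> : ik (freq k) = Complex 0 1 * real_complex R (k%:~R ^+ 5 + k%:~R ^+ 3 - k%:~R).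
  rewrite /freq rmorphB rmorphD !rmorphXn/=.
  by apply: complexP; rewrite !ReImE /=; ring.
rewrite rmorphB rmorphD !rmorphXn.
set y := real_complex R _; have i2 : (Complex 0 1 : R[i]) ^+ 2 = -1 by exact: sqr_i.
set w := Complex 0 1 in i2 *.
have -> : (w * y) ^+ 5 = (w ^+ 2) ^+ 2 * w * y ^+ 5 by ring.
have -> : (w * y) ^+ 3 = w ^+ 2 * w * y ^+ 3 by ring.
by rewrite i2; ring.
Qed.

(** If h and A h are in L^2, this inequality puts h in H^5. *)
Lemma freq_sqr_ge (k : int) :
  (1 + (k%:~R : R) ^+ 2) ^+ 5 <= 1 + 32 * (freq k)%:~R ^+ 2.
Proof.
have [->|k0] := eqVneq k 0;
  first by rewrite /freq !expr0n/= !(addr0, subr0, expr0n)/= mulr0 addr0 expr1n.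
have k1 : 1 <= (k%:~R : R) ^+ 2.
  rewrite -rmorphXn -[1]/(1%:~R) ler_int -gtz0_ge1.
  by rewrite exprn_even_gt0//= orbC k0.
rewrite /freq rmorphB rmorphD !rmorphXn/=; set y := k%:~R in k1 *.
have -> : (y ^+ 5 + y ^+ 3 - y) ^+ 2 = y ^+ 2 * ((y ^+ 2) ^+ 2 + y ^+ 2 - 1) ^+ 2 by ring.
set s := y ^+ 2 in k1 *.
apply: (@le_trans _ _ (32 * (s * (s ^+ 2) ^+ 2))); last first.
  rewrite ler_wpDl// ler_wpM2l// ler_wpM2l//; first by lra.
  by rewrite ler_pXn2r// ?nnegrE; nra.
have -> : 32 * (s * (s ^+ 2) ^+ 2) = (2 * s) ^+ 5 by ring.
by rewrite ler_pXn2r// ?nnegrE; lra.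
Qed.

(** Weak derivatives only see the interior of (0, 2 pi). It is the decay of
    the coefficients required by H5p that provides periodic derivatives, with
    coefficients (ik)^j times those of h, and these are the weak derivatives
    by uniqueness. *)
Lemma opA_iff h g : L2 0 tau h -> L2 0 tau g ->
  opA h g <-> forall k, fourier g k = ik (freq k) * fourier h k.
Proof.
move=> hh hg; split.
  move=> [h5 [d1 [d3 [d5 [w1 w3 w5 gE]]]]] k.
  have [e1 [he1 e1E we1]] := weak_derivative_exists h5 (isT : (1 <= 5)%N).
  have [e3 [he3 e3E we3]] := weak_derivative_exists h5 (isT : (3 <= 5)%N).
  have [e5 [he5 e5E we5]] := weak_derivative_exists h5 (isT : (5 <= 5)%N).
  rewrite -ik_freq !mulrBl -[X in _ - X * _]expr1 -e1E -e3E -e5E.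
  rewrite -!fourierB//; last exact: L2B.
  apply: L2eq_fourier => //; first by apply: L2B => //; exact: L2B.
  apply: (L2eq_trans gE); apply: L2eqB; last exact: weak_derivative_unique w1 we1.
  by apply: L2eqB; [exact: weak_derivative_unique w5 we5|exact:
    weak_derivative_unique w3 we3].
move=> gE; have h5 : H5p h.
  split => //; apply/(bsum_esum zenum_bij (fun k => mulr_ge0 (sqr_ge0 _) (exprn_ge0 5
    (addr_ge0 ler01 (sqr_ge0 _))))).
  apply: (bsum_le _ (bsumD (bessel zenum_inj hh) (bsumZ (ler0n R 32) (bessel
    zenum_inj hg)))).
  move=> n; rewrite /comp gE [normc (ik _ * _)]normcM normc_ik exprMn real_normK
    ?num_real//.
  have := freq_sqr_ge (zenum n) => /(ler_wpM2l (sqr_ge0 (normc (fourier h (zenum n))))).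
  by move=> /le_trans; apply; rewrite le_eqVlt; apply/orP; left; apply/eqP; ring.
split => //.
have [e1 [he1 e1E we1]] := weak_derivative_exists h5 (isT : (1 <= 5)%N).
have [e3 [he3 e3E we3]] := weak_derivative_exists h5 (isT : (3 <= 5)%N).
have [e5 [he5 e5E we5]] := weak_derivative_exists h5 (isT : (5 <= 5)%N).
exists e1, e3, e5; split => //.
apply: fourier_unique => //; first by apply: L2B => //; exact: L2B.
move=> k; rewrite !fourierB//; last exact: L2B.
by rewrite gE -ik_freq !mulrBl e1E e3E e5E expr1.
Qed.

End Generator.

(** * The group generated by the operator *)

Section EvolutionGroup.
Context {R : realType}.
Local Notation Re := complex.Re.
Local Notation Im := complex.Im.
Local Notation mu := (@lebesgue_measure R).
Local Notation tau := (2 * pi).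
Implicit Types (h g : R -> R[i]).

Lemma cvg_eq_fun {T : Type} {F : set_system T} (u w : T -> R) (l : R) :
  (forall t, w t = u t) -> u t @[t --> F] --> l -> w t @[t --> F] --> l.
Proof. by move=> /funext ->. Qed.

Lemma cvg_mull0 {T : Type} {F : set_system T} {FF : Filter F} (u : T -> R) (c : R) :
  u t @[t --> F] --> (0:R) -> c * u t @[t --> F] --> (0:R).
Proof. by move=> u0; have := cvgM (cvg_cst c) u0; rewrite mulr0; apply. Qed.

Lemma lipschitz_of_is_derive (F f : R -> R) (M x y : R) :
  (forall z : R, is_derive z 1 F (f z)) -> (forall z, `|f z| <= M) ->
  `|F y - F x| <= M * `|y - x|.
Proof.
move=> dF fM.
have lt_case a b : a < b -> `|F b - F a| <= M * `|b - a|.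
  move=> ab; have [c _ ->] := @MVT _ F f a b ab (fun z _ => dF z)
    (continuous_subspaceT (is_derive_continuous dF)).
  by rewrite normrM ler_wpM2r.
have [xy|yx|->] := ltgtP x y; first exact: lt_case.
  by rewrite distrC [`|y - x|]distrC; exact: lt_case.
by rewrite !subrr normr0 mulr0.
Qed.

Lemma normc_expi_sub_le (j : int) (s t : R) :
  normc (expi j s - expi j t) <= 2 * `|j%:~R| * `|s - t|.
Proof.
rewrite (le_trans (normc_le_ReIm _))// !ReImE /= -mulrA mulr2n mulrDl mul1r.
apply: lerD.
  apply: (@lipschitz_of_is_derive (fun y => cos (j%:~R * y)) _ _ _ _
    (is_derive_cosM j%:~R)) => z.
  by rewrite normrN normrM ler_piMr// ler_norml sin_geN1 sin_le1.
apply: (@lipschitz_of_is_derive (fun y => sin (j%:~R * y)) _ _ _ _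
  (is_derive_sinM j%:~R)) => z.
by rewrite normrM ler_piMr// ler_norml cos_geN1 cos_le1.
Qed.

Lemma normc_expi_sub1_le (j : int) (t : R) :
  normc (expi j t - 1) <= 2 * `|j%:~R| * `|t|.
Proof. by have := normc_expi_sub_le j t 0; rewrite expi_0r subr0. Qed.

Lemma normc_expi_sub1_cvg (j : int) :
  normc (expi j t - 1) @[t --> (0:R)] --> (0:R).
Proof.
apply: (@squeeze_cvg0 _ _ _ _ _ (fun t : R => 2 * `|j%:~R| * `|t|)).
  by move=> t; rewrite normc_ge0 normc_expi_sub1_le.
rewrite -[X in _ --> X](mulr0 (2 * `|j%:~R : R|)).
apply: cvgM; first exact: cvg_cst.
by rewrite -[X in _ --> X](@normr0 _ R); apply: cvg_norm; exact: cvg_id.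
Qed.

(** Difference quotient of t |-> exp(i j t) at 0. *)
Definition expi_quot (j : int) (t : R) : R[i] :=
  real_complex R t^-1 * (expi j t - 1).

Lemma expi_quot_le (j : int) (t : R) : normc (expi_quot j t) <= 2 * `|j%:~R|.
Proof.
have [->|t0] := eqVneq t 0; first by rewrite /expi_quot invr0 mul0r normc0 mulr_ge0.
rewrite normcM normcR normfV mulrC ler_pdivrMr ?normr_gt0//.
exact: normc_expi_sub1_le.
Qed.

Lemma expi_quot_cvg (j : int) :
  normc (expi_quot j t - ik j) @[t --> (0:R)^'] --> (0:R).
Proof.
have quot (F : R -> R) df : is_derive (0:R) 1 F df ->
    `|t^-1 * (F t - F 0) - df| @[t --> (0:R)^'] --> (0:R).
  move=> [dF <-]; apply: (iffLR (cvg_distP _ _)).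
  rewrite (_ : (fun t => t^-1 * (F t - F 0)) =
    (fun t : R => t^-1 *: ((F \o shift 0) (t *: 1) - F 0))); first exact: dF.
  by apply/funext => t; rewrite /= addr0 [t *: 1]mulr1.
have c1 := quot _ _ (is_derive_cosM j%:~R 0).
have c2 := quot _ _ (is_derive_sinM j%:~R 0).
apply: (@squeeze_cvg0 _ _ _ _ _ (fun t =>
    `|t^-1 * (cos (j%:~R * t) - cos (j%:~R * 0)) - - (j%:~R * sin (j%:~R * 0))| +
    `|t^-1 * (sin (j%:~R * t) - sin (j%:~R * 0)) - j%:~R * cos (j%:~R * 0)|)).
  move=> t; rewrite normc_ge0 (le_trans (normc_le_ReIm _))// !ReImE /=.
  by rewrite !(mulr0, cos0, sin0, mul0r, subr0, oppr0, addr0, mulr1).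
by have := cvgD c1 c2; rewrite addr0; apply.
Qed.

Lemma synth_exists (c : int -> R[i]) : exists s, L2 0 tau s /\
  (bsum (fun n => normc (c (zenum n)) ^+ 2) -> forall k, fourier s k = c k).
Proof.
have [b|nb] := pselect (bsum (fun n => normc (c (zenum n)) ^+ 2)).
  have [s [hs sE _]] := riesz_fischer_fourier zenum_inj b.
  by exists s; split => // _ k; have [n <-] := zenum_surj k.
by exists (fun=> 0); split => //; exact: L2_cst.
Qed.

(** A function with prescribed square-summable Fourier coefficients. *)
Definition synth (c : int -> R[i]) : R -> R[i] := sval (cid (synth_exists c)).

Lemma L2_synth c : L2 0 tau (synth c).
Proof. by have [] := svalP (cid (synth_exists c)). Qed.

Lemma fourier_synth c k : bsum (fun n => normc (c (zenum n)) ^+ 2) ->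
  fourier (synth c) k = c k.
Proof. by have [_ sE] := svalP (cid (synth_exists c)) => /sE. Qed.

#[local] Opaque synth.

Definition evol (t : R) (h : R -> R[i]) :=
  synth (fun k => expi (freq k) t * fourier h k).

Lemma L2_evol t h : L2 0 tau (evol t h).
Proof. exact: L2_synth. Qed.

Lemma fourier_evol t h k : L2 0 tau h ->
  fourier (evol t h) k = expi (freq k) t * fourier h k.
Proof.
move=> hh; rewrite fourier_synth//; apply: bsum_le (bessel zenum_inj hh) => n.
by rewrite [normc (expi _ _ * _)]normcM normc_expi mul1r.
Qed.

Lemma sqnorm_fourier h g : L2 0 tau h -> L2 0 tau g ->
  (forall k, normc (fourier h k) = normc (fourier g k)) ->
  sqnorm 0 tau h = sqnorm 0 tau g.
Proof.
move=> hh hg e.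
rewrite -(cvg_lim (@Rhausdorff R) (parseval_sqnorm hh)).
rewrite -(cvg_lim (@Rhausdorff R) (parseval_sqnorm hg)).
congr (lim (_ @ \oo)); apply/funext => n; apply: eq_bigr => i _.
by rewrite /hat e.
Qed.

Lemma L2sqnorm_cvg0 (a b : R) {T : Type} {F : set_system T} {FF : Filter F}
    (D : T -> R -> R[i]) : (forall t, L2 a b (D t)) ->
  L2sqnorm a b (D t) @[t --> F] --> 0%E <-> sqnorm a b (D t) @[t --> F] --> (0:R).
Proof.
move=> hD; under eq_fun do rewrite L2sqnormE//.
split=> [/fine_cvgP[_]//|c0].
by apply/fine_cvgP; split; [exact: nearW|exact: c0].
Qed.

(** Dominated convergence in the Parseval series. *)
Lemma L2sqnorm_cvg0_fourier {T : Type} {F : set_system T} {FF : Filter F}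
    (D : T -> R -> R[i]) (B : int -> R) :
  (forall t, L2 0 tau (D t)) -> (forall k, 0 <= B k) ->
  bsum (fun n => B (zenum n)) ->
  (\forall t \near F, forall k, normc (fourier (D t) k) ^+ 2 <= B k) ->
  (forall k, normc (fourier (D t) k) @[t --> F] --> (0:R)) ->
  L2sqnorm 0 tau (D t) @[t --> F] --> 0%E.
Proof.
move=> hD B0 bB DB D0; apply/(L2sqnorm_cvg0 hD).
apply: (@bsum_dominated R T F FF (fun t n => tau * normc (hat (D t) n) ^+ 2)
  (fun n => tau * B (zenum n))).
- by move=> t i; rewrite mulr_ge0 ?sqr_ge0// ltW ?tau_gt0.
- by move=> i; rewrite mulr_ge0// ltW ?tau_gt0.
- by apply: bsumZ => //; rewrite ltW ?tau_gt0.
- apply: filterS DB => t DB i; apply: ler_wpM2l; first exact: ltW tau_gt0.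
  exact: DB.
- move=> i; have c := D0 (zenum i).
  have c2 : normc (hat (D t) i) ^+ 2 @[t --> F] --> (0:R).
    by have := cvgM c c; rewrite mulr0; apply.
  have := cvgM (cvg_cst (tau : R)) c2.
  by rewrite mulr0; apply.
- by move=> t; exact: parseval_sqnorm.
Qed.

Lemma evol_isometry_group : isometry_group (evol : R -> (R -> R[i]) -> R -> R[i]).
Proof.
have hE := L2_evol; split.
- by [].
- move=> t a h g hh hg; have hl : L2 0 tau (fun x => a * h x + g x).
    by apply: L2D => //; exact: L2Z.
  apply: fourier_unique => //; first by apply: L2D => //; exact: L2Z.
  move=> k; rewrite fourier_evol// !fourierD//; [|exact: L2Z..].
  by rewrite !fourierZ// !fourier_evol// mulrDr mulrCA.
- move=> t h hh; rewrite !L2sqnormE//; congr (_%:E); apply: sqnorm_fourier => // k.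
  by rewrite fourier_evol// [normc (expi _ _ * _)]normcM normc_expi mul1r.
- move=> h hh; apply: fourier_unique => // k.
  by rewrite fourier_evol// expi_0r mul1r.
- move=> s t h hh; apply: fourier_unique; [exact: hE|exact: hE|move=> k].
  by rewrite !fourier_evol// expi_addr mulrA.
- move=> h hh; apply: (@L2sqnorm_cvg0_fourier R (nbhs (0:R)) _
    (fun t x => evol t h x - h x) (fun k => 4 * normc (fourier h k) ^+ 2)).
  + by move=> t; exact: L2B.
  + by move=> k; rewrite mulr_ge0// sqr_ge0.
  + by apply: bsumZ => //; exact: (bessel zenum_inj hh).
  + apply: nearW => t k; rewrite fourierB// fourier_evol//.
    rewrite (le_trans (normc_sqrD _ _))// [normc (expi _ _ * _)]normcM normc_expi
      mul1r normcN.
    by rewrite le_eqVlt; apply/orP; left; apply/eqP; ring.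
  + move=> k.
    apply: (cvg_eq_fun _ (cvg_mull0 (normc (fourier h k)) (normc_expi_sub1_cvg (freq
      k)))) => t.
    by rewrite fourierB// fourier_evol// -normcM mulrBr mulr1 [_ * fourier h k]mulrC.
Qed.

Lemma fourier_quotient t h g k : L2 0 tau h -> L2 0 tau g ->
  fourier (fun x => real_complex R t^-1 * (evol t h x - h x) - g x) k
  = (expi_quot (freq k) t - ik (freq k)) * fourier h k
    + (ik (freq k) * fourier h k - fourier g k).
Proof.
move=> hh hg; have hE := L2_evol t h.
rewrite fourierB ?fourierZ ?fourierB ?fourier_evol//; [|exact: L2B|].
  by rewrite /expi_quot; ring.
by apply: L2Z; exact: L2B.
Qed.

(** On Fourier coefficients the difference quotient acts as expi_quot, which is
    dominated by 2 |freq k| and tends to i freq(k). Conversely, convergence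
    in L^2 implies that of every coefficient. *)
Lemma evol_generates : generates (@opA R) evol.
Proof.
split; first exact: evol_isometry_group.
move=> h g hh hg.
have hD t : L2 0 tau (fun x => real_complex R t^-1 * (evol t h x - h x) - g x).
  by apply: L2B => //; apply: L2Z; apply: L2B => //; exact: L2_evol.
split=> [/(opA_iff hh hg) gE|].
  apply: (@L2sqnorm_cvg0_fourier R ((0:R)^') _
    (fun t x => real_complex R t^-1 * (evol t h x - h x) - g x) (fun k => 10 * normc
      (fourier g k) ^+ 2)) => //.
  - by move=> k; rewrite mulr_ge0// sqr_ge0.
  - by apply: bsumZ => //; exact: (bessel zenum_inj hg).
  - apply: nearW => t k; rewrite fourier_quotient// -gE subrr addr0.
    rewrite [normc (_ * _)]normcM exprMn gE [normc (ik _ * _)]normcM exprMn [leRHS]mulrA.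
    rewrite ler_wpM2r ?sqr_ge0// (le_trans (normc_sqrD _ _))// normcN.
    have : normc (expi_quot (freq k) t) ^+ 2 <= 4 * normc (ik (freq k) : R[i]) ^+ 2.
      have -> : 4 * normc (ik (freq k) : R[i]) ^+ 2 = (2 * normc (ik (freq k) :
        R[i])) ^+ 2.
        by ring.
      by rewrite ler_pXn2r ?nnegrE ?normc_ge0 ?mulr_ge0 ?normc_ge0// normc_ik
        expi_quot_le.
    by move=> *; lra.
  - move=> k.
    apply: (cvg_eq_fun _ (cvg_mull0 (normc (fourier h k)) (expi_quot_cvg (freq k)))) => t.
    by rewrite fourier_quotient// -gE subrr addr0 -normcM [in RHS]mulrC.
move=> /(L2sqnorm_cvg0 hD) D0; apply/(opA_iff hh hg) => k.
have c1 : normc (fourier (fun x => real_complex R t^-1 * (evol t h x - h x) - g x) k)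
    @[t --> (0:R)^'] --> (0:R).
  apply: (cvg_eq_fun _ (cvg_mull0 (normc (real_complex R tau^-1))
    (L2inner_cvg0 hD (L2_expi 0 tau k) D0))) => t.
  by rewrite fourierE -normcM.
have c2 : normc (fourier h k) * normc (expi_quot (freq k) t - ik (freq k))
    @[t --> (0:R)^'] --> (0:R).
  by apply: cvg_mull0; exact: expi_quot_cvg.
have c3 : normc (fourier (fun x => real_complex R t^-1 * (evol t h x - h x) - g x) k)
    + normc (fourier h k) * normc (expi_quot (freq k) t - ik (freq k)) @[t -->
      (0:R)^'] --> (0:R).
  by have := cvgD c1 c2; rewrite addr0; apply.
suff c4 : normc (ik (freq k) * fourier h k - fourier g k) @[t --> (0:R)^'] --> (0:R).
  apply/eqP; rewrite eq_sym -subr_eq0; apply/eqP/eq0_normc.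
  by rewrite -(cvg_lim (@Rhausdorff R) c4) lim_cst.
apply: (squeeze_cvg0 _ c3) => t; rewrite normc_ge0 andTb fourier_quotient//.
set b := _ - fourier g k; rewrite [_ * fourier h k]mulrC -normcM;
  set a := fourier h k * _.
have {1}-> : b = (a + b) - a by rewrite addrAC subrr add0r.
by rewrite (le_trans (normcD _ _))// normcN.
Qed.

End EvolutionGroup.

(** * Uniqueness of the group on Fourier modes *)

Section AnyGroup.
Context {R : realType}.
Local Notation Re := complex.Re.
Local Notation Im := complex.Im.
Local Notation mu := (@lebesgue_measure R).
Local Notation tau := (2 * pi).
Implicit Types (h g : R -> R[i]).

Lemma cvg_div2 (t : R) : t != 0 -> (t / 2 ^+ n) @[n --> \oo] --> (0:R)^'.
Proof.
move=> t0.
have c : (t / 2 ^+ n) @[n --> \oo] --> (0:R).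
  rewrite -[X in _ --> X](mulr0 t); apply: cvgM; first exact: cvg_cst.
  under eq_fun do rewrite -exprVn.
  by apply: cvg_expr; rewrite ger0_norm; lra.
move=> A [e /= e0 hA]; have /cvgrPdist_lt/(_ _ e0) := c.
apply: filterS => n; rewrite /= => cn; apply: hA => //=.
by rewrite mulf_neq0// invr_neq0// expf_neq0.
Qed.

Section Mode.
Variable S : R -> (R -> R[i]) -> R -> R[i].
Hypothesis Sgen : generates (@opA R) S.
Let Siso := Sgen.1.
Variable k : int.
Let e := expi k : R -> R[i].
Let w t := expi (freq k) t : R[i].
Let q t := sqnorm 0 tau (fun x => S t e x - w t * e x).

Let He : L2 0 tau e := L2_expi _ _ _.
Let HS t : L2 0 tau (S t e) := group_L2 Siso t He.

Let q_double t : q (t + t) <= 4 * q t.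
Proof.
pose z x := S t e x - w t * e x.
have hz : L2 0 tau z by apply: L2B => //; exact: L2Z.
have hSz : L2 0 tau (S t z) by exact: (group_L2 Siso).
have yE : S t e = (fun x => w t * e x + z x).
  by apply/funext => x; rewrite /z addrC subrK.
have e1 := group_add Siso t t He.
have e2 : L2eq 0 tau (S t (S t e)) (fun x => w t * S t e x + S t z x).
  by rewrite [X in S t X]yE; exact: (group_linear Siso).
have e3 : L2eq 0 tau (fun x => S (t + t) e x - w (t + t) * e x)
    (fun x => w t * z x + S t z x).
  apply: ae_imply (L2eq_trans e1 e2) => x /= E xI; rewrite (E xI).
  by rewrite /z /w expi_addr; ring.
rewrite /q (L2eq_sqnorm _ _ e3); last 2 first.
- by apply: L2B; [exact: (group_L2 Siso)|exact: L2Z].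
- by apply: L2D => //; exact: L2Z.
rewrite (le_trans (sqnormD_le _ _))//; first exact: L2Z.
have -> : sqnorm 0 tau (S t z) = sqnorm 0 tau z.
  by have := group_isometry Siso t hz; rewrite !L2sqnormE// => -[].
rewrite sqnormZ// normc_expi expr1n mul1r -/z.
by rewrite le_eqVlt; apply/orP; left; apply/eqP; rewrite /z; ring.
Qed.

Let q_scale t n : q t <= (2 ^+ n) ^+ 2 * q (t / 2 ^+ n).
Proof.
elim: n => [|n ih]; first by rewrite !expr0 divr1 expr1n mul1r.
have tE : t / 2 ^+ n = t / 2 ^+ n.+1 + t / 2 ^+ n.+1.
  by rewrite [2 ^+ n.+1]exprS; field; rewrite expf_neq0.
have E : (2 ^+ n.+1) ^+ 2 = (2 ^+ n) ^+ 2 * 4 :> R by rewrite [2 ^+ n.+1]exprS; ring.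
rewrite (le_trans ih)// E -mulrA ler_wpM2l ?sqr_ge0// tE.
exact: q_double.
Qed.

Let Q t := 2 * sqnorm 0 tau (fun x => real_complex R t^-1 * (S t e x - e x) - ik
  (freq k) * e x)
  + 2 * (normc (expi_quot (freq k) t - ik (freq k)) ^+ 2 * sqnorm 0 tau e).

Let Q_cvg0 : Q t @[t --> (0:R)^'] --> (0:R).
Proof.
have hg : L2 0 tau (fun x => ik (freq k) * e x) by exact: L2Z.
have hop : opA e (fun x => ik (freq k) * e x).
  by apply/(opA_iff He hg) => j; rewrite fourierZ// fourier_expi;
    case: eqVneq => [->//|_]; rewrite !mulr0.
have D0 := (Sgen.2 _ _ He hg).1 hop.
have hD t : L2 0 tau (fun x => real_complex R t^-1 * (S t e x - e x) - ik (freq k) * e x).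
  by apply: L2B => //; apply: L2Z; exact: L2B.
move/(L2sqnorm_cvg0 hD) : D0 => D0.
have c2 : normc (expi_quot (freq k) t - ik (freq k)) ^+ 2 @[t --> (0:R)^'] --> (0:R).
  have c := @expi_quot_cvg R (freq k).
  by have := cvgM c c; rewrite mulr0; apply.
have c3 : 2 * (normc (expi_quot (freq k) t - ik (freq k)) ^+ 2 * sqnorm 0 tau e)
    @[t --> (0:R)^'] --> (0:R).
  by apply: cvg_mull0; have := cvgM c2 (cvg_cst (sqnorm 0 tau e)); rewrite mul0r; apply.
by have := cvgD (cvg_mull0 2 D0) c3; rewrite addr0; apply.
Qed.

Let q_le t : t != 0 -> q t <= t ^+ 2 * Q t.
Proof.
move=> t0; have tc : real_complex R t * real_complex R t^-1 = 1.
  by rewrite -rmorphM mulfV.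
rewrite /q (_ : (fun x => _) = (fun x => real_complex R t *
   ((real_complex R t^-1 * (S t e x - e x) - ik (freq k) * e x)
    + (- (expi_quot (freq k) t - ik (freq k))) * e x))); last first.
  apply/funext => x; rewrite /expi_quot -/(w t); set c := real_complex R t^-1 in tc *.
  have -> : S t e x - w t * e x
    = (real_complex R t * c) * (S t e x - w t * e x) by rewrite tc mul1r.
  by ring.
have hD : L2 0 tau (fun x => real_complex R t^-1 * (S t e x - e x) - ik (freq k) * e x).
  by apply: L2B; [apply: L2Z; exact: L2B|exact: L2Z].
rewrite sqnormZ; last by apply: L2D => //; exact: L2Z.
rewrite normcR real_normK ?num_real// ler_wpM2l ?sqr_ge0//.
rewrite (le_trans (sqnormD_le hD (L2Z _ He)))//.
by rewrite sqnormZ// normcN.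
Qed.

(** Let q(t) be the squared norm of S(t) e - exp(i freq(k) t) e, with e =
    exp(ikx). Additivity and isometry give q(2t) <= 4 q(t), and q(t) = o(t^2)
    at 0 because e is an eigenvector of the generator. Hence q(t) <= 4^n q(t
    / 2^n), which tends to 0. *)
Lemma group_mode t : L2eq 0 tau (S t (expi k)) (fun x => expi (freq k) t * expi k x).
Proof.
have q0 : q t = 0.
  have [->|t0] := eqVneq t 0.
    transitivity (sqnorm 0 tau (fun=> 0 : R[i])).
      apply: L2eq_sqnorm; [by apply: L2B => //; exact: L2Z|exact: L2_cst|].
      by apply: ae_imply (group_id Siso He) => x /= E xI;
        rewrite E// /w expi_0r mul1r subrr.
    rewrite /sqnorm (@eq_Rintegral _ _ _ mu _ (fun=> 0)).
      by rewrite /Rintegral integral0.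
    by move=> x _; rewrite normc0 expr0n.
  apply/eqP; rewrite eq_le sqnorm_ge0 andbT.
  have c : t ^+ 2 * Q (t / 2 ^+ n) @[n --> \oo] --> (0:R).
    apply: cvg_mull0; exact: cvg_comp (cvg_div2 t0) Q_cvg0.
  rewrite -(cvg_lim (@Rhausdorff R) c); apply: limr_ge; first exact: cvgP c.
  apply: nearW => n; apply: (le_trans (q_scale t n)).
  have tn0 : t / 2 ^+ n != 0 by rewrite mulf_neq0// invr_neq0// expf_neq0.
  apply: (le_trans (ler_wpM2l (sqr_ge0 _) (q_le tn0))).
  rewrite mulrA -exprMn mulrCA mulfV ?mulr1// expf_neq0//.
have hz : L2 0 tau (fun x => S t e x - w t * e x) by apply: L2B => //; exact: L2Z.
by apply: ae_imply (sqnorm_eq0 hz q0) => x /= E /E /eqP; rewrite subr_eq0 => /eqP.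
Qed.

(** A linear isometry preserves inner products, by polarization. *)
Lemma group_inner t h : L2 0 tau h ->
  L2inner 0 tau (S t e) (S t h) = L2inner 0 tau e h.
Proof.
move=> hh; have hSh : L2 0 tau (S t h) by exact: (group_L2 Siso).
have isoE g : L2 0 tau g -> sqnorm 0 tau (S t g) = sqnorm 0 tau g.
  move=> hg; have := group_isometry Siso t hg.
  rewrite !L2sqnormE//; last exact: (group_L2 Siso).
  by move=> [].
have pol a : Re (a * L2inner 0 tau (S t e) (S t h)) = Re (a * L2inner 0 tau e h).
  have hl : L2 0 tau (fun x => a * e x + h x) by apply: L2D => //; exact: L2Z.
  have := isoE _ hl.
  rewrite (L2eq_sqnorm _ _ (group_linear Siso t a He hh)); last 2 first.
  - exact: (group_L2 Siso).
  - by apply: L2D => //; exact: L2Z.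
  rewrite !sqnormD ?sqnormZ ?isoE ?L2innerZl//; try exact: L2Z.
  by move=> /addrI /mulfI; apply; rewrite pnatr_eq0.
apply: complexP; first by have := pol 1; rewrite !mul1r.
have := pol (Complex 0 1); rewrite !cReM /= !mul0r !mul1r !sub0r.
by move=> /oppr_inj.
Qed.

(** By isometry, the inner product of h with e is that of S(t) h with S(t) e,
    and S(t) e is known. *)
Lemma fourier_group t h : L2 0 tau h ->
  fourier (S t h) k = expi (freq k) t * fourier h k.
Proof.
move=> hh; have hSh : L2 0 tau (S t h) by exact: (group_L2 Siso).
have hwe : L2 0 tau (fun x => w t * e x) by exact: L2Z.
have := group_inner t hh.
rewrite (ae_eq_L2inner (HS t) hwe hSh (group_mode t)) L2innerZl//.
rewrite (L2innerC hSh He) (L2innerC hh He) => /(congr1 (@conjc R)).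
rewrite conjcM !conjcK => E; rewrite !fourierE -E mulrCA; congr (_ * _).
by rewrite mulrA [w t * _]mulrC expi_conj mul1r.
Qed.

End Mode.
End AnyGroup.

(** * The control *)

Section Control.
Context {R : realType}.
Local Notation Re := complex.Re.
Local Notation Im := complex.Im.
Local Notation mu := (@lebesgue_measure R).
Local Notation tau := (2 * pi).
Implicit Types (f v h g phi : R -> R[i]).

(** The quotient (freq j - freq k) / (j - k) is a polynomial which is
    positive at all integer points but the origin. *)
Lemma freq_inj : injective freq.
Proof.
move=> j k e; apply/eqP; rewrite -subr_eq0; apply/negPn/negP => jk.
pose P := j ^+ 4 + j ^+ 3 * k + j ^+ 2 * k ^+ 2 + j * k ^+ 3 + k ^+ 4
  + (j ^+ 2 + j * k + k ^+ 2) - 1.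
have /eqP : (j - k) * P = 0.
  by transitivity (freq j - freq k); [rewrite /freq /P; ring|rewrite e subrr].
rewrite mulf_eq0 (negPf jk)/= => /eqP P0.
have jk0 : 0 < j ^+ 2 + k ^+ 2.
  rewrite lt0r addr_ge0 ?sqr_ge0// andbT paddr_eq0 ?sqr_ge0// !sqrf_eq0.
  by apply: contra jk => /andP[/eqP -> /eqP ->]; rewrite subrr.
have s1 : 1 <= j ^+ 2 + j * k + k ^+ 2.
  rewrite -gtz0_ge1 -(pmulr_rgt0 _ (ltr0n int 2)).
  have -> : 2 * (j ^+ 2 + j * k + k ^+ 2) = (j + k) ^+ 2 + (j ^+ 2 + k ^+ 2) by ring.
  by rewrite ltr_wpDl ?sqr_ge0.
pose q := j ^+ 4 + j ^+ 3 * k + j ^+ 2 * k ^+ 2 + j * k ^+ 3 + k ^+ 4.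
have q0 : 0 < 2 * q.
  have -> : 2 * q = ((j ^+ 2 + j * k) ^+ 2 + (k ^+ 2 + j * k) ^+ 2)
     + ((j ^+ 2) ^+ 2 + (k ^+ 2) ^+ 2) by rewrite /q; ring.
  rewrite ltr_wpDl ?addr_ge0 ?sqr_ge0// lt0r addr_ge0 ?sqr_ge0// andbT.
  by rewrite paddr_eq0 ?sqr_ge0// !sqrf_eq0; apply: contraL jk0 =>
    /andP[/eqP -> /eqP ->]; rewrite !expr0n.
by move: P0; rewrite /P -/q => ?; lra.
Qed.

(** The numbers freq(k) are distinct integers, so the functions exp(i freq(k)
    s) are orthogonal on (0, 2 pi) and the moment problem is solved by a
    Fourier series. The weight in tildeH is at least 1, which makes the
    prescribed coefficients square summable. *)
Lemma control_exists f (u0 : R -> R[i]) (beta : R) : 0 < beta ->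
  (forall k, fourier f k != 0) -> tildeH f beta u0 ->
  exists v, L2 0 tau v /\ forall k,
    real_complex R tau * (fourier f k * fourier v (freq k)) = - fourier u0 k.
Proof.
move=> b0 fk [hu0 hsum].
have w0 (k : int) : 0 <= normc (fourier u0 k / fourier f k) ^+ 2 * expR (beta * k%:~R
  ^+ 6).
  by rewrite mulr_ge0 ?sqr_ge0 ?expR_ge0.
have bw := (bsum_esum zenum_bij w0).1 hsum.
pose c n := - (real_complex R tau^-1 * (fourier u0 (zenum n) / fourier f (zenum n))).
have bc : bsum (fun n => normc (c n) ^+ 2).
  apply: (bsum_le _ (bsumZ (sqr_ge0 (tau^-1 : R)) bw)) => n.
  rewrite /c normcN [normc (real_complex R _ * _)]normcM normcR exprMn real_normK
    ?num_real//.
  rewrite ler_wpM2l ?sqr_ge0// ler_peMr ?sqr_ge0// -expR0 ler_expR.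
  by rewrite mulr_ge0 ?(ltW b0)// exprn_even_ge0.
have inj : injective (freq \o zenum) := inj_comp freq_inj zenum_inj.
have [v [hv vE _]] := riesz_fischer_fourier inj bc.
exists v; split => // k; have [n <-] := zenum_surj k.
rewrite [fourier v _](vE n) /c !mulrN; congr (- _).
have t1 : real_complex R tau * real_complex R tau^-1 = 1.
  by rewrite -rmorphM mulfV// lt0r_neq0 ?tau_gt0.
transitivity ((real_complex R tau * real_complex R tau^-1)
  * (fourier f (zenum n) / fourier f (zenum n)) * fourier u0 (zenum n)).
  by ring.
by rewrite t1 mulfV ?fk// !mul1r.
Qed.

(** Testing Duhamel's formula against exp(ikx) at time 2 pi shows that the k-th
    coefficient of u is exp(2 pi i freq(k)) (u0_k + 2 pi f_k v_freq(k)). *)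
Lemma solution_final_zero f v (u0 : R -> R[i]) u : L2 0 tau f -> L2 0 tau v -> L2 0
  tau u0 ->
  (forall k, real_complex R tau * (fourier f k * fourier v (freq k)) = - fourier u0 k) ->
  is_solution tau f v u0 u -> L2eq 0 tau (u tau) (fun=> 0).
Proof.
move=> hf hv hu0 moment [S [Sgen cu uE]].
have tI : tau \in `[0, (tau : R)] by rewrite in_itv/= lexx ltW ?tau_gt0.
have [huT _] := cu _ tI; have [w [[hw wE] uw]] := uE _ tI.
have hS t h : L2 0 tau h -> L2 0 tau (S t h) by exact: (group_L2 Sgen.1).
apply: fourier_unique => //; first exact: L2_cst.
move=> k; have hSw : L2 0 tau (fun x => S tau u0 x + w x) by apply: L2D => //; exact: hS.
have -> : fourier (fun=> 0 : R[i]) k = 0.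
  rewrite fourierE (_ : L2inner _ _ _ _ = 0) ?mulr0//.
  by rewrite /L2inner; under [X in cint _ _ X]eq_fun do rewrite mul0r; rewrite cint0.
rewrite (L2eq_fourier k huT hSw uw) fourierD//; last exact: hS.
rewrite (fourier_group Sgen)// [fourier w k]fourierE (wE _ (L2_expi _ _ k)).2.
have -> : cint 0 tau (fun s => L2inner 0 tau (fun x => v s * S (tau - s) f x) (expi k))
    = cint 0 tau (fun s => (expi (freq k) tau * (real_complex R tau * fourier f k)) *
                     (v s * conjc (expi (freq k) s))).
  apply: eq_cint => s _; rewrite L2innerZl; [|exact: hS|exact: L2_expi].
  rewrite L2innerE (fourier_group Sgen)// [expi _ (tau - s)]expi_addr expi_oppr.
  by ring.
rewrite cintZ; last by apply: L2inner_cintegrable => //; exact: L2_expi.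
rewrite -/(L2inner 0 tau v (expi (freq k))) L2innerE.
have t1 : real_complex R tau^-1 * real_complex R tau = 1.
  by rewrite -rmorphM mulVf// lt0r_neq0 ?tau_gt0.
rewrite (_ : real_complex R tau^-1 * _ = (real_complex R tau^-1 * real_complex R tau) *
  (expi (freq k) tau * (real_complex R tau * (fourier f k * fourier v (freq k)))));
    last by ring.
by rewrite t1 mul1r moment mulrN subrr.
Qed.

Section Existence.
Variables (T : R) (f v u0 : R -> R[i]).
Hypothesis T0 : 0 < T.
Hypothesis hf : L2 0 tau f.
Hypothesis hv : L2 0 T v.
Hypothesis hu0 : L2 0 tau u0.

(** The k-th coefficient of the integral in Duhamel's formula is
    exp(i freq(k) t) f_k (duhamel t k). *)
Definition duhamel (t : R) (k : int) :=
  cint 0 t (fun s => v s * conjc (expi (freq k) s)).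

Let kern (k : int) (s : R) := v s * conjc (expi (freq k) s).

Let normc_kern k s : normc (kern k s) = normc (v s).
Proof. by rewrite /kern [normc (_ * _)]normcM normc_conj normc_expi mulr1. Qed.

Lemma kern_integrable k : cintegrable 0 T (kern k).
Proof. by apply: L2inner_cintegrable => //; exact: L2_expi. Qed.

Lemma duhamel_bounded : exists V, 0 <= V /\ forall t k, t \in `[0, T] ->
  normc (duhamel t k) <= V.
Proof.
exists (2 * \int[mu]_(x in `]0, T[) normc (v x)); split.
  by rewrite mulr_ge0//; apply: Rintegral_ge0 => x _; exact: normc_ge0.
move=> t k; rewrite in_itv/= => /andP[t0 tT].
have ik0 := cintegrable_normc (L2_cintegrable hv).
apply: (le_trans (normc_cint_le (g := fun x => normc (v x)) _ _ _)).
- by apply: cintegrableS (kern_integrable k).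
- apply: integrableS ik0 => //.
  by apply: subset_itv; rewrite bnd_simp.
- by move=> x _; rewrite -(normc_kern k x); exact: lexx.
rewrite ler_wpM2l// /Rintegral fine_le//.
- apply: integrable_fin_num => //; apply: integrableS ik0 => //.
  by apply: subset_itv; rewrite bnd_simp.
- exact: integrable_fin_num.
- apply: ge0_subset_integral => //.
  + exact: measurable_int ik0.
  + by move=> x _; rewrite lee_fin normc_ge0.
  + by apply: subset_itv; rewrite bnd_simp.
Qed.

Lemma duhamel_continuous t k : t \in `[0, T] ->
  normc (duhamel s k - duhamel t k) @[s --> within [set` `[0, T]] (nbhs t)] --> (0:R).
Proof.
move=> tI.
have part (p : R -> R) : mu.-integrable `]0, T[ (EFin \o p) ->
    `|\int[mu]_(x in `]0, s[) p x - \int[mu]_(x in `]0, t[) p x|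
      @[s --> within [set` `[0, T]] (nbhs t)] --> (0:R).
  move=> ip; set g := p \_ `]0, T[.
  have ig (A : set R) : measurable A -> mu.-integrable A (EFin \o g).
    move=> mA; apply: (@integrableS _ _ _ mu setT) => //.
    by rewrite /g -restrict_EFin; exact/(integrable_mkcond _ _).1.
  have pE s : s \in `[0, T] ->
      \int[mu]_(x in `]0, s[) p x = \int[mu]_(x in `[0, s]) g x.
    rewrite in_itv/= => /andP[s0 sT].
    rewrite -Rintegral_itv_bndo_bndc; last exact: ig.
    rewrite -Rintegral_itv_obnd_cbnd; last exact: ig.
    apply: eq_Rintegral => x; rewrite inE/= in_itv/= => /andP[x0 xs].
    by rewrite /g patchE mem_set//= in_itv/= x0 (lt_le_trans xs).
  have c : (\int[mu]_(x in `[0, s]) g x) @[s --> within [set` `[0, T]] (nbhs t)]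
      --> \int[mu]_(x in `[0, t]) g x.
    rewrite nbhs_subspace_in//.
    exact: (@parameterized_integral_continuous R 0 T g (ltW T0) (ig _ (measurable_itv
      _)) t).
  apply: (iffLR (cvg_distP _ _)); rewrite pE//.
  apply: cvg_trans c; apply: near_eq_cvg; near=> s; rewrite pE//.
  near: s; exact: withinT.
have [i1 i2] := kern_integrable k.
apply: (@squeeze_cvg0 _ _ _ _ _ (fun s =>
  `|\int[mu]_(x in `]0, s[) Re (kern k x) - \int[mu]_(x in `]0, t[) Re (kern k x)| +
  `|\int[mu]_(x in `]0, s[) Im (kern k x) - \int[mu]_(x in `]0, t[) Im (kern k x)|)).
  by move=> s; rewrite normc_ge0 (le_trans (normc_le_ReIm _))// !ReImE.
by have := cvgD (part _ i1) (part _ i2); rewrite addr0; apply.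
Unshelve. all: by end_near. Qed.

Let wcoef t k := expi (freq k) t * (fourier f k * duhamel t k).
Let ycoef t k := expi (freq k) t * fourier u0 k + wcoef t k.

Lemma wcoef_bounded : exists K, 0 <= K /\ forall t k, t \in `[0, T] ->
  normc (wcoef t k) ^+ 2 <= K * normc (fourier f k) ^+ 2.
Proof.
have [V [V0 hV]] := duhamel_bounded; exists (V ^+ 2); split; first exact: sqr_ge0.
move=> t k tI; rewrite [normc (expi _ _ * _)]normcM normc_expi mul1r.
rewrite [normc (_ * _)]normcM exprMn mulrC ler_wpM2r ?sqr_ge0//.
by rewrite ler_pXn2r ?nnegrE ?normc_ge0 ?hV.
Qed.

Lemma bsum_wcoef t : t \in `[0, T] -> bsum (fun n => normc (wcoef t (zenum n)) ^+ 2).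
Proof.
move=> tI; have [K [K0 hK]] := wcoef_bounded.
apply: (bsum_le _ (bsumZ K0 (bessel zenum_inj hf))) => n; exact: hK.
Qed.

Let ybound k := 2 * normc (fourier u0 k) ^+ 2
  + 2 * (sval (cid wcoef_bounded) * normc (fourier f k) ^+ 2).

Let ycoef_le t k : t \in `[0, T] -> normc (ycoef t k) ^+ 2 <= ybound k.
Proof.
move=> tI; rewrite /ybound; case: cid => K [K0 hK]; rewrite [sval _]/=.
rewrite /ycoef (le_trans (normc_sqrD _ _))// [normc (expi _ _ * fourier _ _)]normcM
  normc_expi mul1r.
by rewrite lerD2l ler_wpM2l// hK.
Qed.

Let ybound_ge0 k : 0 <= ybound k.
Proof.
have := @ycoef_le 0 k; rewrite in_itv/= lexx (ltW T0) => /(_ isT).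
by apply: le_trans; exact: sqr_ge0.
Qed.

Let bsum_ybound : bsum (fun n => ybound (zenum n)).
Proof.
rewrite /ybound; case: cid => K [K0 hK]; rewrite [sval _]/=; apply: bsumD;
  apply: bsumZ => //.
  exact: (bessel zenum_inj hu0).
by apply: bsumZ => //; exact: (bessel zenum_inj hf).
Qed.

Let bsum_ycoef t : t \in `[0, T] -> bsum (fun n => normc (ycoef t (zenum n)) ^+ 2).
Proof. by move=> tI; apply: bsum_le bsum_ybound => n; exact: ycoef_le. Qed.

Let ycoef_continuous t k : t \in `[0, T] ->
  normc (ycoef s k - ycoef t k) @[s --> within [set` `[0, T]] (nbhs t)] --> (0:R).
Proof.
move=> tI; pose A s := fourier u0 k + fourier f k * duhamel s k.
have yE s : ycoef s k = expi (freq k) s * A s by rewrite /ycoef /wcoef /A; ring.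
have c1 : normc (A t) * (2 * `|(freq k)%:~R| * `|s - t|)
    @[s --> within [set` `[0, T]] (nbhs t)] --> (0:R).
  apply: cvg_mull0; apply: cvg_mull0; apply: (iffLR (cvg_distP _ _)).
  by apply: cvg_within_filter; exact: cvg_id.
have c2 : normc (fourier f k) * normc (duhamel s k - duhamel t k)
    @[s --> within [set` `[0, T]] (nbhs t)] --> (0:R).
  by apply: cvg_mull0; exact: duhamel_continuous.
apply: (@squeeze_cvg0 _ _ _ _ _ (fun s =>
  normc (A t) * (2 * `|(freq k)%:~R| * `|s - t|)
  + normc (fourier f k) * normc (duhamel s k - duhamel t k))).
  move=> s; rewrite normc_ge0 andTb !yE.
  have -> : expi (freq k) s * A s - expi (freq k) t * A t
      = A t * (expi (freq k) s - expi (freq k) t) + expi (freq k) s * (fourier f k *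
        (duhamel s k - duhamel t k)).
    by rewrite /A; ring.
  rewrite (le_trans (normcD _ _))// [normc (A t * _)]normcM.
  rewrite [normc (expi _ s * _)]normcM normc_expi mul1r [normc (fourier _ _ * _)]normcM.
  by rewrite lerD2r ler_wpM2l ?normc_ge0// normc_expi_sub_le.
by have := cvgD c1 c2; rewrite addr0; apply.
Qed.

(** Parseval expands the inner product with phi into a series, which
    dominated convergence allows to integrate term by term. *)
Lemma duhamel_L2_integral t : t \in `[0, T] ->
  is_L2_integral t (fun s x => v s * evol (t - s) f x) (synth (wcoef t)).
Proof.
move=> tI; move: (tI); rewrite in_itv/= => /andP[t0 tT].
split; first exact: L2_synth.
move=> phi hphi.
have hE s : L2 0 tau (evol s f) := L2_evol s f.
have hvt : L2 0 t v by apply: L2S hv.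
pose a n := hat f n * conjc (hat phi n).
pose F N s := v s * \sum_(0 <= n < N) real_complex R tau * (expi (freq (zenum n)) (t
  - s) * a n).
pose F' N s := \sum_(0 <= n < N)
  real_complex R tau * (expi (freq (zenum n)) t * a n) * kern (zenum n) s.
have FE N : F N = F' N.
  apply/funext => s; rewrite /F /F' mulr_sumr; apply: eq_bigr => n _.
  by rewrite /kern expi_addr expi_oppr; ring.
have ikt k : cintegrable 0 t (kern k) by exact: cintegrableS (kern_integrable k).
have iF N : cintegrable 0 t (F N).
  by rewrite FE; apply: cintegrable_sum => n; exact: cintegrableZ.
have mF N : cmeas `]0, t[ (F N) by exact: cintegrable_cmeas.
have [B hB] := bsumD (bessel zenum_inj hf) (bessel zenum_inj hphi).
have aB N s : normc (\sum_(0 <= n < N) real_complex R tau * (expi (freq (zenum n)) (t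
  - s) * a n))
    <= tau * B.
  rewrite (le_trans (normc_sum _ _))// (le_trans _ (ler_wpM2l (ltW tau_gt0) (hB N)))//.
  rewrite mulr_sumr; apply: ler_sum => n _.
  rewrite [normc (real_complex _ _ * _)]normcM normcR gtr0_norm ?tau_gt0//.
  rewrite ler_wpM2l ?(ltW tau_gt0)// [normc (expi _ _ * _)]normcM normc_expi mul1r.
  rewrite (le_trans (normcM_le _ _ ltr01))// invr1 !mul1r normc_conj /hat.
  by rewrite ler_pdivrMr// ler_peMr ?addr_ge0 ?sqr_ge0// (ler_nat _ 1 2).
have iv : mu.-integrable `]0, t[ (EFin \o (fun s => tau * B * normc (v s))).
  apply: integrable_mulr; apply: cintegrable_normc; exact: L2_cintegrable.
have FB N s : s \in `]0, t[ -> normc (F N s) <= tau * B * normc (v s).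
  by move=> _; rewrite [normc (_ * _)]normcM mulrC ler_wpM2r ?normc_ge0.
have Fcvg s : s \in `]0, t[ ->
    normc (F N s - L2inner 0 tau (fun x => v s * evol (t - s) f x) phi) @[N --> \oo]
      --> (0:R).
  move=> _.
  apply: (cvg_eq_fun _ (cvg_mull0 (normc (v s)) (parseval_inner (hE (t - s)) hphi))) => N.
  rewrite L2innerZl// -normcM mulrBr; congr (normc (v s * _ - _)).
  by apply: eq_bigr => n _; rewrite /a /hat fourier_evol//; ring.
have [iFl cFl] := cint_dominated mF iv FB Fcvg.
split => //; apply: (complex_cvg_unique _ cFl).
apply: (cvg_eq_fun _ (parseval_inner (L2_synth (wcoef t)) hphi)) => N.
congr (normc (_ - _)); rewrite FE cint_sum; last by move=> n; exact: cintegrableZ.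
apply: eq_bigr => n _; rewrite cintZ// /hat fourier_synth; last exact: bsum_wcoef.
by rewrite /wcoef /duhamel /a /hat /kern; ring.
Qed.

(** The solution is defined by its Fourier coefficients; they are continuous
    in t and dominated by a square-summable sequence, whence continuity in
    L^2. *)
Lemma solution_exists : exists u, is_solution T f v u0 u.
Proof.
exists (fun t => synth (ycoef t)), evol; split; first exact: evol_generates.
  move=> t tI; split; first exact: L2_synth.
  apply: (@L2sqnorm_cvg0_fourier R R (within [set` `[0, T]] (nbhs t)) _
    (fun s x => synth (ycoef s) x - synth (ycoef t) x) (fun k => 4 * ybound k)).
  - by move=> s; apply: L2B; exact: L2_synth.
  - by move=> k; rewrite mulr_ge0.
  - exact: bsumZ.
  - near=> s => k; have sI : s \in `[0, T] by near: s; exact: withinT.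
    rewrite fourierB; [|exact: L2_synth..].
    rewrite !fourier_synth; [|exact: bsum_ycoef..].
    rewrite (le_trans (normc_sqrD _ _))// normcN.
    have := ycoef_le k sI; have := ycoef_le k tI.
    by move=> *; lra.
  - move=> k; apply: cvg_trans (ycoef_continuous k tI); apply: near_eq_cvg.
    near=> s; have sI : s \in `[0, T] by near: s; exact: withinT.
    rewrite fourierB; [|exact: L2_synth..].
    by rewrite !fourier_synth; [|exact: bsum_ycoef..].
move=> t tI; exists (synth (wcoef t)); split; first exact: duhamel_L2_integral.
have h1 := L2_synth (wcoef t); have h2 := L2_evol t u0.
apply: fourier_unique; [exact: L2_synth|exact: L2D|move=> k].
rewrite fourierD// fourier_evol// !fourier_synth//; [exact: bsum_wcoef|exact: bsum_ycoef].
Unshelve. all: by end_near. Qed.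

End Existence.
End Control.

Theorem theorem2p5 (R : realType) (f : R -> R[i]) (b beta : R)
    (hf : L2 0 (2 * pi) f)
    (hfk : forall k : int, fourier f k != 0)
    (hb : 0 < b)
    (hB : property_B b)
    (hbeta : b <= beta) :
  exists T : R, 0 < T /\
    forall u0 : R -> R[i], tildeH f beta u0 ->
      exists v : R -> R[i], L2 0 T v /\
        (exists u : R -> R -> R[i], is_solution T f v u0 u) /\
        (forall u : R -> R -> R[i], is_solution T f v u0 u ->
           L2eq 0 (2 * pi) (u T) (fun=> 0)).
Proof.
exists (2 * pi); split; first exact: tau_gt0.
move=> u0 hu0; have hL := hu0.1.
have [v [hv moment]] := control_exists (lt_le_trans hb hbeta) hfk hu0.
exists v; split => //; split; first exact: solution_exists tau_gt0 hf hv hL.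
by move=> u; exact: solution_final_zero.
Qed.
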